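(* Let $n\ge 3$, $A=(a_1,\dots,a_n)$ positive integers, $\Pi=\prod_{i=1}^n\{0,\dots,a_i\}$. The scheme $\mathring{Y}\subset(\mathbb{C}^\times)^\Pi$ cut out by the equations $$x_{I+e_j+e_\ell}\,x_{I+e_k}=x_I\,x_{I+e_j+e_k+e_\ell}+x_{I+e_j+e_k}\,x_{I+e_\ell}+x_{I+e_k+e_\ell}\,x_{I+e_j}\qquad(1\le j<k<\ell\le n,\ \text{all admissible } I)$$ is an irreducible variety of dimension $\sum_{i<j}a_ia_j+\sum_ia_i+1$. Moreover, if $T$ is any tiling of $P$, then $\{x_J\}_{J\in\mathrm{vert}(T)}$ is a transcendence basis for the coordinate ring of $\mathring{Y}$.
   Context: $C=\prod_{i=1}^n[0,a_i]$ is the cubical complex with vertex set $\Pi$; fix $0<\theta_1<\dots<\theta_n<\pi$, $v_i=(\cos\theta_i,\sin\theta_i)$, $\pi(x)=\sum x_iv_i$, $P=\pi(C)$. A tiling is a two-dimensional subcomplex $T\subset C$ with $\pi|_T:T\to P$ a homeomorphism; $\mathrm{vert}(T)\subset\Pi$ is its vertex set. *)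

(* Defs.v *)
From HB Require Import structures.
From mathcomp Require Import all_boot all_order all_algebra.
From mathcomp Require Import complex.
From mathcomp Require Import all_classical all_reals all_analysis.
From mathcomp Require mpoly.
(* The notations of mpoly clash with those of the analysis library. *)
Import -(notations) mpoly.

Set Implicit Arguments.
Unset Strict Implicit.
Unset Printing Implicit Defensive.

Import Order.TTheory GRing.Theory Num.Theory.
Import numFieldNormedType.Exports.

Local Open Scope classical_set_scope.
Local Open Scope ring_scope.
Local Open Scope quotient_scope.

(* The library quotient {ideal_quot I} asks for a proper ideal; here the ideal
   may be the whole ring, so the quotient is only a comPzRingType (it may be
   the zero ring). *)
Section QuotientByGenerators.
Variables (S : comNzRingType) (G : set S).

Definition ideal_gen : {pred S} := fun p =>
  `[< exists s : seq (S * S),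
        (forall cg, cg \in s -> G cg.2) /\ p = \sum_(cg <- s) cg.1 * cg.2 >].

Lemma ideal_genMl c p : p \in ideal_gen -> c * p \in ideal_gen.
Proof.
move=> /asboolP[s [sG ->]]; apply/asboolP.
exists [seq (c * cg.1, cg.2) | cg <- s]; split.
  by move=> _ /mapP[cg cgs ->]; exact: (sG cg).
by rewrite big_map mulr_sumr; apply: eq_bigr => cg _ /=; rewrite mulrA.
Qed.

Lemma ideal_gen_zmod_closed : zmod_closed ideal_gen.
Proof.
have D p q : p \in ideal_gen -> q \in ideal_gen -> p + q \in ideal_gen.
  move=> /asboolP[s [sG ->]] /asboolP[t [tG ->]]; apply/asboolP.
  exists (s ++ t); rewrite big_cat; split=> // cg.
  by rewrite mem_cat => /orP[/sG|/tG].
split; first by apply/asboolP; exists [::]; rewrite big_nil; split.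
by move=> p q pI qI; apply: D => //; rewrite -mulN1r; apply: ideal_genMl.
Qed.

HB.instance Definition _ :=
  GRing.isZmodClosed.Build S ideal_gen ideal_gen_zmod_closed.

Definition gquot : Type := Quotient.quot (ideal_gen : zmodClosed S).

HB.instance Definition _ := GRing.Zmodule.on gquot.
HB.instance Definition _ :=
  EqQuotient.copy gquot (Quotient.quot (ideal_gen : zmodClosed S)).

Definition gquot_one : gquot := \pi_gquot 1.
Definition gquot_mul (x y : gquot) : gquot := \pi_gquot (repr x * repr y).

Lemma gquot_eqP (x y : S) : \pi_gquot x = \pi_gquot y <-> x - y \in ideal_gen.
Proof.
by rewrite (Quotient.idealrBE (ideal_gen : zmodClosed S)); split=> /eqP.
Qed.

Lemma gquot_piM : {morph \pi_gquot : x y / x * y >-> gquot_mul x y}.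
Proof.
move=> x y; apply/gquot_eqP.
rewrite -[_ * _](addrNK (x * repr (\pi_gquot y))) -mulrBr -addrA -mulrBl.
apply: rpredD; last rewrite mulrC; apply: ideal_genMl; apply/gquot_eqP.
  by rewrite reprK.
by rewrite reprK.
Qed.

Lemma gquot_piD : {morph \pi_gquot : x y / x + y}.
Proof.
by move=> x y; exact: (raddfD (\pi_(Quotient.quot (ideal_gen : zmodClosed S)))).
Qed.

Lemma gquot_mulA : associative gquot_mul.
Proof.
elim/quotW=> x; elim/quotW=> y; elim/quotW=> z.
by rewrite -[gquot_mul (\pi y) _]gquot_piM -[gquot_mul (\pi x) (\pi y)]gquot_piM
           -!gquot_piM mulrA.
Qed.

Lemma gquot_mulC : commutative gquot_mul.
Proof. by move=> x y; rewrite /gquot_mul mulrC. Qed.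

Lemma gquot_mul1 : left_id gquot_one gquot_mul.
Proof. by elim/quotW=> x; rewrite -gquot_piM mul1r. Qed.

Lemma gquot_mulDl : left_distributive gquot_mul +%R.
Proof.
elim/quotW=> x; elim/quotW=> y; elim/quotW=> z.
by rewrite -gquot_piD -!gquot_piM -gquot_piD mulrDl.
Qed.

HB.instance Definition _ := GRing.Zmodule_isComPzRing.Build gquot
  gquot_mulA gquot_mulC gquot_mul1 gquot_mulDl.

Definition gquot_pi (p : S) : gquot := \pi_gquot p.

Lemma gquot_pi_zmod_morphism : zmod_morphism gquot_pi.
Proof.
by move=> x y; exact: (raddfB (\pi_(Quotient.quot (ideal_gen : zmodClosed S)))).
Qed.

Lemma gquot_pi_monoid_morphism : monoid_morphism gquot_pi.
Proof. by split=> // x y; exact: gquot_piM. Qed.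

HB.instance Definition _ :=
  GRing.isZmodMorphism.Build S gquot gquot_pi gquot_pi_zmod_morphism.
HB.instance Definition _ :=
  GRing.isMonoidMorphism.Build S gquot gquot_pi gquot_pi_monoid_morphism.

End QuotientByGenerators.

Section AffineSchemes.
Variable A : comPzRingType.

Definition integral_domain : Prop :=
  (1 : A) <> 0 /\ forall x y : A, x * y = 0 -> x = 0 \/ y = 0.

Definition prime_ideal (p : set A) : Prop :=
  [/\ p 0, forall x y, p x -> p y -> p (x + y), forall x y, p y -> p (x * y),
      ~ p 1 & forall x y, p (x * y) -> p x \/ p y].

Definition prime_chain (d : nat) (p : nat -> set A) : Prop :=
  (forall i, (i <= d)%N -> prime_ideal (p i)) /\
  (forall i, (i < d)%N -> p i `<` p i.+1).

Definition krull_dim_eq (d : nat) : Prop :=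
  (exists p, prime_chain d p) /\
  (forall m p, prime_chain m p -> (m <= d)%N).

End AffineSchemes.

Section TranscendenceBasis.
Variables (K : fieldType) (A : comPzRingType) (iota : {rmorphism K -> A}).
Variables (V : finType) (x : V -> A).

(* The library's mmap, restated because it does not allow the zero ring. *)
Definition mp_eval (p : mpoly #|V| K) : A :=
  \sum_(m <- msupp p)
     iota (mcoeff m p) * \prod_(i < #|V|) x (enum_val i) ^+ m i.

Definition alg_independent : Prop :=
  forall p : mpoly #|V| K, mp_eval p = 0 -> p = 0.

(* f is a root of a nonzero polynomial with coefficients in the subalgebra
   generated by the family x; the coefficient of degree i is mp_eval (q i). *)
Definition algebraic_over (f : A) : Prop :=
  exists (d : nat) (q : 'I_d -> mpoly #|V| K),
    (exists i, mp_eval (q i) <> 0) /\ \sum_(i < d) mp_eval (q i) * f ^+ i = 0.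

Definition transcendence_basis : Prop :=
  alg_independent /\ forall f : A, algebraic_over f.

End TranscendenceBasis.

Section CubicalComplex.
Variables (n : nat) (a : 'I_n -> nat).

Definition grid := {dffun forall i : 'I_n, 'I_(a i).+1}.

(* I + \sum_(i in D) e_i is again a grid point; this is what makes the value
   of inord below meaningful. *)
Definition fits (I : grid) (D : {set 'I_n}) : bool :=
  [forall i in D, (I i < a i)%N].

Definition grid_shift (I : grid) (D : {set 'I_n}) : grid :=
  [ffun i : 'I_n => inord (I i + (i \in D)) : 'I_(a i).+1].

(* When fits I D, (I, D) stands for the cell which is the product over i of
   [I i, I i + 1] if i is in D and of the point I i otherwise. *)
Definition cell := (grid * {set 'I_n})%type.

Definition face (c' c : cell) : bool :=
  (c'.2 \subset c.2) &&
  [exists U : {set 'I_n},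
     (U \subset c.2 :\: c'.2) && (c'.1 == grid_shift c.1 U)].

Definition subcomplex (T : {set cell}) : Prop :=
  (forall c, c \in T -> fits c.1 c.2) /\
  (forall c c', c \in T -> face c' c -> c' \in T).

Definition complex_dim (T : {set cell}) : nat := (\max_(c in T) #|c.2|)%N.

Definition vert (T : {set cell}) : {set grid} :=
  finset (fun J => (J, finset.set0) \in T).

Section Geometry.
Variables (R : realType) (theta : 'I_n -> R).

Definition cell_set (c : cell) : set 'rV[R]_n :=
  [set x : 'rV[R]_n | forall i : 'I_n,
     (i \in c.2 -> (c.1 i)%:R <= x ord0 i <= (c.1 i)%:R + 1) /\
     (i \notin c.2 -> x ord0 i = (c.1 i)%:R)].

Definition realization (T : {set cell}) : set 'rV[R]_n :=
  [set x | exists2 c, c \in T & cell_set c x].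

Definition cube_box : set 'rV[R]_n :=
  [set x : 'rV[R]_n | forall i : 'I_n, 0 <= x ord0 i <= (a i)%:R].

Definition dirvec (t : R) : 'rV[R]_2 :=
  \row_(k < 2) (if k == ord0 then cos t else sin t).

Definition planar_proj (x : 'rV[R]_n) : 'rV[R]_2 :=
  \sum_(i < n) x ord0 i *: dirvec (theta i).

Definition shadow : set 'rV[R]_2 := planar_proj @` cube_box.

Definition homeomorphism_on (E F : topologicalType) (X : set E) (Y : set F)
    (f : E -> F) : Prop :=
  [/\ set_bij X Y f, {within X, continuous f} &
      exists g : F -> E, {in X, cancel f g} /\ {within Y, continuous g}].

Definition tiling (T : {set cell}) : Prop :=
  [/\ subcomplex T, complex_dim T = 2%N &
      homeomorphism_on (realization T) shadow planar_proj].

End Geometry.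
End CubicalComplex.

Section CubeRecurrence.
Variables (R : realType) (n : nat) (a : 'I_n -> nat).

Local Notation N := #|{: grid a}|.

(* C[x_J, y_J : J in the grid]; modulo x_J * y_J = 1 this is the Laurent
   polynomial ring, i.e. the coordinate ring of the torus. *)
Definition ambient := mpoly (N + N) R[i].

Definition xvar (J : grid a) : ambient :=
  mpolyX R[i] (mnm1 (lshift N (enum_rank J))).
Definition yvar (J : grid a) : ambient :=
  mpolyX R[i] (mnm1 (rshift N (enum_rank J))).

Definition cube_eq (I : grid a) (j k l : 'I_n) : ambient :=
  let X (D : {set 'I_n}) := xvar (grid_shift I D) in
  X [set j; l]%SET * X [set k]%SET -
  (X finset.set0 * X [set j; k; l]%SET + X [set j; k]%SET * X [set l]%SET +
   X [set k; l]%SET * X [set j]%SET).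

Definition relations : set ambient :=
  [set p | (exists J : grid a, p = xvar J * yvar J - 1) \/
           (exists (I : grid a) (j k l : 'I_n),
              [/\ (j < k)%N, (k < l)%N, fits I [set j; k; l]%SET
                & p = cube_eq I j k l])].

Definition coord_ring : comPzRingType := gquot relations.

Definition coord_fun (J : grid a) : coord_ring := gquot_pi relations (xvar J).

Definition scalar_map : {rmorphism R[i] -> coord_ring} :=
  gquot_pi relations \o @mpolyC (N + N) R[i].

End CubeRecurrence.

Arguments coord_ring R {n} a.
Arguments coord_fun R {n a} J.
Arguments scalar_map R {n} a.

(* Main.v *)
(* Solving a cube equation for x_{I+e_j+e_k+e_l} determines all x_I from those
   with at most two nonzero coordinates in I, and the equations are consistent:
   on a 4-cube every way of computing the top vertex gives
   x_0 x_1234 = x_12 x_34 - x_13 x_24 + x_14 x_23. None of the resulting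
   rational functions vanishes identically, because
   x_I = prod_{j<k} tan(alpha_k - alpha_j)^(I_j I_k) is a nowhere zero solution
   (addition formula for the tangent). Hence the coordinate ring is, up to
   inverting some elements, a polynomial ring in these
   N = sum_{i<j} a_i a_j + sum_i a_i + 1 variables; this gives integrality and
   the dimension.

   A tiling T is swept from its right boundary to its left boundary by monotone
   paths, one tile at a time. The sweep is a maximal chain of adjacent swaps of
   words, so T has at most N vertices, and by the argument of Matsumoto's
   theorem any two such chains differ by commutations and braid moves, the
   latter being cube flips; hence every x_I is a fraction in the x_J with J a
   vertex of T. A relation among these x_J would allow a chain of N + 2 primes
   in a polynomial ring in at most N variables. *)
Require Import Defs.
From HB Require Import structures.
From mathcomp Require Import all_boot all_order all_algebra.
From mathcomp Require Import complex zify ring lra.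
From mathcomp Require Import all_classical all_reals all_analysis.
From mathcomp Require mpoly.
Import -(notations) mpoly.

Set Implicit Arguments.
Unset Strict Implicit.
Unset Printing Implicit Defensive.

Import Order.TTheory GRing.Theory Num.Theory.
Import numFieldNormedType.Exports.

Local Open Scope classical_set_scope.
Local Open Scope ring_scope.

(** * Polynomial rings and chains of primes *)

Section PolynomialRings.
Variables (r : nat) (K : comNzRingType).
Implicit Types p q : mpoly r K.

Lemma mpoly_ring_ind (P : mpoly r K -> Prop) :
  (forall c, P (mpolyC r c)) -> (forall i, P (mpolyX K (mnm1 i))) ->
  (forall p q, P p -> P q -> P (p + q)) ->
  (forall p q, P p -> P q -> P (p * q)) -> forall p, P p.
Proof.
move=> PC PX PD PM p; rewrite [p]mpolyE.
have P0 : P 0 by rewrite -(mpolyC0 r K).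
have P1 : P 1 by rewrite -(mpolyC1 r K).
elim/big_ind: _ => // m _; rewrite -mul_mpolyC mpolyXE_id; apply: (PM) => //.
elim/big_ind: _ => // i _.
by elim: (m i) => [|e IH]; rewrite ?expr0 // exprS; apply: PM.
Qed.

Lemma eq_rmorph_mpoly (A : comPzRingType) (f g : {rmorphism mpoly r K -> A}) :
  (forall c, f (mpolyC r c) = g (mpolyC r c)) ->
  (forall i, f (mpolyX K (mnm1 i)) = g (mpolyX K (mnm1 i))) -> f =1 g.
Proof.
move=> fgC fgX p; elim/mpoly_ring_ind: p => // p q pE qE.
  by rewrite !rmorphD pE qE.
by rewrite !rmorphM pE qE.
Qed.

End PolynomialRings.

Section LastVariable.
Variables (r : nat) (K : comNzRingType).

Lemma muniX_max : muni (mpolyX K (mnm1 ord_max)) = 'X :> {poly mpoly r K}.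
Proof.
rewrite muniE msuppX big_seq1 mcoeffX eqxx scale1r mnm1E eqxx expr1.
rewrite -[RHS]scale1r -mpolyX0; congr (mpolyX _ _ *: _).
by apply/mnmP=> i; rewrite mnmE mnm0E mnm1E -val_eqE /= gtn_eqF.
Qed.

Lemma muniX_widen (i : 'I_r) :
  muni (mpolyX K (mnm1 (widen_ord (leqnSn r) i))) = (mpolyX K (mnm1 i))%:P.
Proof.
rewrite muniE msuppX big_seq1 mcoeffX eqxx scale1r mnm1E -val_eqE /= ltn_eqF //.
rewrite expr0 alg_polyC; congr (mpolyX _ _)%:P.
by apply/mnmP=> j; rewrite mnmE !mnm1E -!val_eqE.
Qed.

Lemma mmap_muni (A : comNzRingType) (f : {rmorphism K -> A}) (z : 'I_r.+1 -> A)
    (p : mpoly r.+1 K) :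
  mmap f z p =
  (map_poly (mmap f (z \o widen_ord (leqnSn r))) (muni p)).[z ord_max].
Proof.
pose g : {rmorphism mpoly r.+1 K -> A} := horner_eval (z ord_max) \o
  map_poly (mmap f (z \o widen_ord (leqnSn r))) \o @muni r K.
rewrite -[RHS]/(g p); apply: eq_rmorph_mpoly => [c|i] /=; rewrite /horner_eval.
  by rewrite muniC map_polyC hornerC /= !mmapC.
rewrite mmapX mmap1U; case: (unliftP ord_max i) => [j ->|->].
  have -> : lift ord_max j = widen_ord (leqnSn r) j.
    by apply: val_inj; rewrite /= /bump leqNgt ltn_ord.
  by rewrite muniX_widen map_polyC hornerC /= mmapX mmap1U.
by rewrite muniX_max map_polyX hornerX.
Qed.

Lemma muni_inj : injective (@muni r K).
Proof.
pose g := mmap (@mpolyC r.+1 K) (fun i => mpolyX K (mnm1 i)).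
have g_id : g =1 idfun.
  by apply: eq_rmorph_mpoly => [c|i] /=; rewrite /g ?mmapC ?mmapX ?mmap1U.
by move=> p q pq; rewrite -[p]g_id -[q]g_id /g !mmap_muni pq.
Qed.

End LastVariable.

Section AlgebraicDependence.
Variables (K : fieldType) (r : nat).

Lemma mulmx_row_kernel (m d : nat) (W : 'M[K]_(m, d)) :
  (d < m)%N -> exists2 u : 'rV_m, u != 0 & u *m W = 0.
Proof.
move=> ltdm; have : kermx W != 0.
  rewrite -mxrank_eq0 mxrank_ker subn_eq0 -ltnNge.
  exact: leq_ltn_trans (rank_leq_col W) ltdm.
by case/rowV0Pn=> u uW u0; exists u => //; apply: sub_kermxP.
Qed.

Lemma msize_prod_exp_le (m D M : nat) (z : 'I_m -> mpoly r K)
    (e : 'I_m -> 'I_M) :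
  (forall i, msize (z i) <= D.+1)%N ->
  (msize (\prod_i z i ^+ e i) <= (m * (D * M)).+1)%N.
Proof.
move=> zD; have msizeM_le (p q : mpoly r K) d d' :
    (msize p <= d.+1 -> msize q <= d'.+1 -> msize (p * q) <= (d + d').+1)%N.
  have [->|p0] := eqVneq p 0; first by rewrite mul0r msize0.
  have [->|q0] := eqVneq q 0; first by rewrite mulr0 msize0.
  by rewrite msizeM //; move: (msize p) (msize q) => s t; lia.
have msizeX_le i k : (msize (z i ^+ k) <= (D * k).+1)%N.
  elim: k => [|k IH]; first by rewrite expr0 msize1.
  by rewrite exprS mulnS; apply: msizeM_le.
have -> : (m * (D * M) = \sum_(i < m) D * M)%N.
  by rewrite sum_nat_const card_ord.
elim/big_ind2: _ => [|p d q d'|i _]; first by rewrite msize1.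
  exact: msizeM_le.
by apply: leq_trans (msizeX_le i (e i)) _; rewrite ltnS leq_mul2l ltnW ?orbT.
Qed.

Definition mnm_ffun (s b : nat) (f : {ffun 'I_s -> 'I_b}) : multinom s :=
  Multinom [tuple (f i : nat) | i < s].

Lemma mnm_ffun_inj (s b : nat) : injective (@mnm_ffun s b).
Proof.
move=> f g /mnmP fg; apply/ffunP => i; apply: val_inj.
by have := fg i; rewrite !mnmE.
Qed.

Lemma mpoly_eq0_bounded (b : nat) (p : mpoly r K) : (msize p <= b)%N ->
  (forall f : {ffun 'I_r -> 'I_b}, mcoeff (mnm_ffun f) p = 0) -> p = 0.
Proof.
move=> pb p0; apply/mpolyP => k; rewrite mcoeff0.
have [/msize_mdeg_lt k_lt|/memN_msupp_eq0 //] := boolP (k \in msupp p).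
have kb i : (k i < b)%N.
  apply: leq_trans pb; apply: leq_ltn_trans k_lt.
  by rewrite mdegE (bigD1 i) //= leq_addr.
rewrite -[RHS](p0 [ffun i => Ordinal (kb i)]); congr (mcoeff _ _).
by apply/mnmP=> i; rewrite mnmE ffunE.
Qed.

(* There are M ^ m monomials with exponents below M in m polynomials of degree
   at most D, and all of them have exponents below (m * D + 1) * M. *)
Lemma mpoly_algebraic_dependence (m : nat) (z : 'I_m -> mpoly r K) :
  (r < m)%N -> exists2 q : mpoly m K, q != 0 & mmap (@mpolyC r K) z q = 0.
Proof.
move=> ltrm; pose D := (\max_i msize (z i))%N.
pose M := ((m * D).+1 ^ r).+1; pose L := ((m * D).+1 * M)%N.
pose power (f : {ffun 'I_m -> 'I_M}) := \prod_i z i ^+ f i.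
pose W :=
  \matrix_(f < #|{: {ffun 'I_m -> 'I_M}}|, g < #|{: {ffun 'I_r -> 'I_L}}|)
  mcoeff (mnm_ffun (enum_val g)) (power (enum_val f)).
have [|u u0 uW] := mulmx_row_kernel W.
  rewrite !card_ffun !card_ord /L expnMn (leq_trans _ (leq_pexp2l _ ltrm)) //.
  by rewrite expnS ltn_mul2r expn_gt0 /= ltnS.
pose q := \sum_f u ord0 f *: mpolyX K (mnm_ffun (enum_val f)).
have qE : mmap (@mpolyC r K) z q = \sum_f u ord0 f *: power (enum_val f).
  rewrite raddf_sum; apply: eq_bigr => f _ /=.
  rewrite mmapZ mul_mpolyC mmapX /mmap1; congr (_ *: _).
  by apply: eq_bigr => i _; rewrite mnmE.
exists q.
  apply: contraNneq u0 => q0; apply/eqP/rowP => f; rewrite mxE.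
  rewrite -[RHS](mcoeff0 K (mnm_ffun (enum_val f))) -q0 raddf_sum (bigD1 f) //=.
  rewrite mcoeffZ mcoeffX eqxx mulr1 big1 ?addr0 // => g /negPf gf.
  by rewrite mcoeffZ mcoeffX (inj_eq (@mnm_ffun_inj _ _))
    (inj_eq enum_val_inj) gf mulr0.
rewrite qE; apply: (mpoly_eq0_bounded (b := L)) => [|g].
  elim/big_ind: _ => [|p p' pL p'L|f _]; first by rewrite msize0.
    by apply: leq_trans (mmeasureD_le _ _ _) _; rewrite geq_max pL.
  apply: leq_trans (msizeZ_le _ _) _.
  apply: leq_trans (msize_prod_exp_le (D := D) _ _) _; last by rewrite /L; lia.
  by move=> i; apply/leqW/(leq_bigmax i).
have := congr1 (fun v : 'rV_ _ => v ord0 (enum_rank g)) uW.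
rewrite !mxE => uWg; rewrite -[RHS]uWg raddf_sum; apply: eq_bigr => f _ /=.
by rewrite mcoeffZ !mxE enum_rankK.
Qed.

End AlgebraicDependence.

Section PrimeChains.
Variable A : comNzRingType.
Implicit Types p : set A.

Lemma prime_idealB p x y : prime_ideal p -> p x -> p y -> p (x - y).
Proof. by case=> _ pD pM _ _ px py; rewrite -mulN1r; apply/pD/pM. Qed.

(* The constant term of Q lies in p1 because z does; once it is removed, Q is
   divisible by z, which is cancelled modulo p0. *)
Lemma prime_ideal_poly_free (D : nzRingType) (f : {rmorphism D -> A}) p0 p1 z :
  prime_ideal p0 -> prime_ideal p1 -> (p0 `<=` p1)%classic -> p1 z -> ~ p0 z ->
  (forall d, p1 (f d) -> d = 0) ->
  forall Q : {poly D}, p0 (map_poly f Q).[z] -> Q = 0.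
Proof.
move=> [_ _ _ _ p0prime] p1I p01 p1z p0z f0.
elim/poly_ind=> // Q d IH;
  rewrite rmorphD rmorphM /= map_polyX map_polyC hornerMXaddC.
move=> p0Qd; have d0 : d = 0.
  apply: f0; rewrite -[f d](addKr ((map_poly f Q).[z] * z)) addrC.
  by apply: prime_idealB (p01 _ p0Qd) _ => //;
    case: p1I => _ _ pM _ _; apply: pM.
move: p0Qd; rewrite d0 /= rmorph0 !addr0 => /p0prime[/IH->|//].
by rewrite mul0r.
Qed.

Variables (K : fieldType) (f : {rmorphism K -> A}).

Lemma prime_chain_mpoly_free (m : nat) (p : nat -> set A) (z : 'I_m -> A) :
  prime_chain m p ->
  (forall i : 'I_m, p (m - i)%N (z i) /\ ~ p (m - i).-1 (z i)) ->
  forall q : mpoly m K, p 0%N (mmap f z q) -> q = 0.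
Proof.
elim: m p z => [|m IH] p z [pI psub] zp q.
  rewrite (nvar0_mpolyC q) mmapC; set c := mcoeff _ q.
  have [->|c0] := eqVneq c 0; first by rewrite mpolyC0.
  have [_ _ pM p1 _] := pI 0%N isT; move/(pM (f c^-1)).
  by rewrite -rmorphM mulVf // rmorph1.
rewrite mmap_muni => pq; apply/muni_inj; rewrite raddf0.
have [pz npz] := zp ord_max; rewrite subSnn in pz npz.
have [sub01 _] := psub 0%N isT.
apply: prime_ideal_poly_free (pI 0%N isT) (pI 1%N isT) sub01 pz npz _ _ pq => d.
apply: (IH (p \o S)) => [|i]; first by split=> i im; [apply: pI | apply: psub].
have := zp (widen_ord (leqnSn m) i).
by rewrite /= (subSn (ltnW (ltn_ord i))) /= prednK // subn_gt0.
Qed.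

End PrimeChains.

Lemma mpoly_prime_chain_le (K : fieldType) (r m : nat)
    (p : nat -> set (mpoly r K)) :
  prime_chain m p -> (m <= r)%N.
Proof.
move=> chain_p; rewrite leqNgt; apply/negP => ltrm; have [_ psub] := chain_p.
have /choice[z zp] (i : 'I_m) : exists x, p (m - i)%N x /\ ~ p (m - i).-1 x.
  have [|_ /existsNP[x /not_implyP[px npx]]] := psub (m - i).-1; first by lia.
  by exists x; rewrite -[(m - i)%N]prednK ?subn_gt0.
have [q q0 zq] := mpoly_algebraic_dependence z ltrm.
case/eqP: q0; apply: (prime_chain_mpoly_free (f := @mpolyC r K) chain_p zp).
by rewrite zq; have [pI _] := chain_p; have [] := pI 0%N isT.
Qed.

(** * Rings of fractions of polynomial rings *)

Section Fractions.
Variables (B : comNzRingType) (A : comPzRingType) (psi : {rmorphism B -> A}).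

Definition is_fraction (c b : B) (x : A) : Prop :=
  (exists u, psi c * u = 1) /\ psi c * x = psi b.

Definition fractional (x : A) : Prop := exists c b, is_fraction c b x.

Lemma is_fraction_image b : is_fraction 1 b (psi b).
Proof.
by rewrite /is_fraction rmorph1 mul1r; split=> //; exists 1; rewrite mul1r.
Qed.

Lemma unit_imageM c c' :
  (exists u, psi c * u = 1) -> (exists u, psi c' * u = 1) ->
  exists u, psi (c * c') * u = 1.
Proof.
by move=> [u cu] [u' cu']; exists (u * u');
  rewrite rmorphM mulrACA cu cu' mulr1.
Qed.

Lemma is_fractionM c b x c' b' y : is_fraction c b x -> is_fraction c' b' y ->
  is_fraction (c * c') (b * b') (x * y).
Proof.
move=> [cu cx] [cu' cy]; split; first exact: unit_imageM.
by rewrite !rmorphM -cx -cy mulrACA.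
Qed.

Lemma is_fractionD c b x c' b' y : is_fraction c b x -> is_fraction c' b' y ->
  is_fraction (c * c') (c' * b + c * b') (x + y).
Proof.
move=> [cu cx] [cu' cy]; split; first exact: unit_imageM.
by rewrite rmorphD !rmorphM -cx -cy; ring.
Qed.

Lemma fractional_image b : fractional (psi b).
Proof. by exists 1, b; apply: is_fraction_image. Qed.

Lemma fractionalM x y : fractional x -> fractional y -> fractional (x * y).
Proof.
by move=> [c [b cx]] [c' [b' cy]]; do 2!eexists; apply: is_fractionM cx cy.
Qed.

Lemma fractionalD x y : fractional x -> fractional y -> fractional (x + y).
Proof.
by move=> [c [b cx]] [c' [b' cy]]; do 2!eexists; apply: is_fractionD cx cy.
Qed.

Lemma fractionalN x : fractional x -> fractional (- x).
Proof.
by move=> [c [b [cu cx]]]; exists c, (- b); split; rewrite // mulrN cx rmorphN.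
Qed.

Lemma fractional_inv x y : fractional x -> x * y = 1 -> fractional y.
Proof.
move=> [c [b [[u cu] cx]]] xy; exists b, c; split.
  by exists (y * u); rewrite -cx -mulrA (mulrA x) xy mul1r.
by rewrite -cx -mulrA xy mulr1.
Qed.

Lemma fractional_divl x y z :
  fractional x -> x * y = 1 -> fractional (x * z) -> fractional z.
Proof.
move=> xF xy /(fractionalM (fractional_inv xF xy)).
by rewrite mulrA [y * x]mulrC xy mul1r.
Qed.

Hypothesis all_fractional : forall x, fractional x.

Lemma contract_prime_chain m (p : nat -> set A) :
  prime_chain m p -> prime_chain m (fun i => (psi @^-1` p i)%classic).
Proof.
move=> [pI psub]; split=> i im.
  have [p0 pD pM p1 pP] := pI i im; split=> /=.
  - by rewrite rmorph0.
  - by move=> x y; rewrite rmorphD; apply: pD.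
  - by move=> x y; rewrite rmorphM; apply: pM.
  - by rewrite rmorph1.
  - by move=> x y; rewrite rmorphM; apply: pP.
have [sub /existsNP[x /not_implyP[px npx]]] := psub i im.
split=> [b /=|]; first exact: sub.
move=> /= supset; have [c [b [[u cu] cx]]] := all_fractional x.
have [_ _ pM _ _] := pI i (ltnW im); have [_ _ qM _ _] := pI _ im.
have := supset b; rewrite /= -cx => /(_ (qM _ _ px)) /(pM u).
by rewrite mulrA [u * _]mulrC cu mul1r.
Qed.

Hypothesis psi_inj : forall b, psi b = 0 -> b = 0.

Section Kernel.
Variables (D : idomainType) (phi : {rmorphism B -> D}).
Hypothesis phi_unit : forall c u, psi c * u = 1 -> phi c != 0.

(* The kernel of the extension of phi from B to the ring of fractions A. *)
Definition fraction_kernel : set A :=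
  fun x => exists c b, is_fraction c b x /\ phi b = 0.

Lemma fraction_kernelP x c b :
  is_fraction c b x -> fraction_kernel x <-> phi b = 0.
Proof.
move=> [cu cx]; split=> [|b0]; last by exists c, b.
move=> [c' [b' [[[u' cu'] cx'] b'0]]].
have /(congr1 phi) : c' * b = c * b'.
  apply/eqP; rewrite -subr_eq0; apply/eqP/psi_inj.
  by rewrite rmorphB !rmorphM -cx -cx' mulrCA subrr.
rewrite !rmorphM b'0 mulr0 => /eqP.
by rewrite mulf_eq0 (negPf (phi_unit cu')) => /eqP.
Qed.

Lemma fraction_kernel_prime : prime_ideal fraction_kernel.
Proof.
split.
- by rewrite -(rmorph0 psi) (fraction_kernelP (is_fraction_image _)) rmorph0.
- move=> x y.
  have [[c [b fx]] [c' [b' fy]]] := (all_fractional x, all_fractional y).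
  rewrite (fraction_kernelP fx) (fraction_kernelP fy) => b0 b'0.
  by rewrite (fraction_kernelP (is_fractionD fx fy)) rmorphD !rmorphM b0 b'0
    !mulr0 addr0.
- move=> x y.
  have [[c [b fx]] [c' [b' fy]]] := (all_fractional x, all_fractional y).
  rewrite (fraction_kernelP fy) (fraction_kernelP (is_fractionM fx fy))
    rmorphM => ->.
  by rewrite mulr0.
- rewrite -(rmorph1 psi) (fraction_kernelP (is_fraction_image _)) rmorph1.
  by apply/eqP/oner_neq0.
move=> x y.
have [[c [b fx]] [c' [b' fy]]] := (all_fractional x, all_fractional y).
rewrite (fraction_kernelP (is_fractionM fx fy)) (fraction_kernelP fx)
  (fraction_kernelP fy).
by rewrite rmorphM => /eqP; rewrite mulf_eq0 => /orP[]/eqP; [left|right].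
Qed.

End Kernel.
End Fractions.

Section FractionsOfPolynomials.
Variables (K : fieldType) (r : nat) (A : comPzRingType).
Variable psi : {rmorphism mpoly r K -> A}.
Hypothesis all_fractional : forall x, fractional psi x.

Lemma fractional_prime_chain_le m (p : nat -> set A) :
  prime_chain m p -> (m <= r)%N.
Proof. by move/(contract_prime_chain all_fractional)/mpoly_prime_chain_le. Qed.

(* Otherwise (0) could be added below the contraction of the chain. *)
Lemma long_prime_chain_inj m (p : nat -> set A) :
  prime_chain m p -> (r <= m)%N -> forall b, psi b = 0 -> b = 0.
Proof.
move=> chain_p rm b b0; apply/eqP; apply: contraT => bN0.
have [qI qsub] := contract_prime_chain all_fractional chain_p.
pose q i := if i is i'.+1 then (psi @^-1` p i')%classic else [set 0]%classic.
suff /mpoly_prime_chain_le : prime_chain m.+1 q by rewrite ltnNge rm.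
split=> -[|i] im /=; [|exact: qI| |exact: qsub].
  split=> //=.
  - by move=> x y -> ->; rewrite addr0.
  - by move=> x y ->; rewrite mulr0.
  - by move/eqP; rewrite oner_eq0.
  - by move=> x y /eqP; rewrite mulf_eq0 => /orP[]/eqP; [left|right].
have [p0 _ _ _ _] := qI 0%N isT; split=> [x /= ->|sub] //.
by case/eqP: bN0; apply: sub; move: p0; rewrite /= b0 rmorph0.
Qed.

Hypothesis psi_inj : forall b, psi b = 0 -> b = 0.

Lemma fractional_integral_domain : integral_domain A.
Proof.
split=> [A0|x y xy0].
  by have /eqP := psi_inj (etrans (rmorph1 psi) A0); rewrite oner_eq0.
have zero_num z c b : is_fraction psi c b z -> b = 0 -> z = 0.
  by move=> [[u cu] cz] b0; rewrite -[z]mul1r -cu mulrAC cz b0 rmorph0 mul0r.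
have [[c [b fx]] [c' [b' fy]]] := (all_fractional x, all_fractional y).
have [_] := is_fractionM fx fy; rewrite xy0 mulr0 => /esym/psi_inj/eqP.
by rewrite mulf_eq0 => /orP[]/eqP;
  [left; apply: zero_num fx _|right; apply: zero_num fy _].
Qed.

Variable v : 'I_r -> K.
Hypothesis meval_unit : forall c u, psi c * u = 1 -> meval v c != 0.

Definition freeze (i : nat) : mpoly r K -> mpoly r K :=
  mmap (@mpolyC r K)
    (fun k : 'I_r => if (k < i)%N then mpolyC r (v k) else mpolyX K (mnm1 k)).

HB.instance Definition _ i := GRing.RMorphism.on (freeze i).

Lemma freezeC i c : freeze i (mpolyC r c) = mpolyC r c.
Proof. by rewrite /freeze mmapC. Qed.

Lemma freezeX i k : freeze i (mpolyX K (mnm1 k)) =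
  if (k < i)%N then mpolyC r (v k) else mpolyX K (mnm1 k).
Proof. by rewrite /freeze mmapX mmap1U. Qed.

Lemma meval_freeze i : meval v \o freeze i =1 meval v.
Proof.
apply: eq_rmorph_mpoly => [c|k] /=; first by rewrite freezeC.
by rewrite freezeX; case: ifP => // _; rewrite mevalC mevalXU.
Qed.

Lemma freeze_freezeS i : freeze i.+1 \o freeze i =1 freeze i.+1.
Proof.
apply: eq_rmorph_mpoly => [c|k] /=; first by rewrite !freezeC.
by rewrite freezeX; case: ifP => // ki; rewrite freezeC freezeX leqW.
Qed.

Lemma freeze_unit i c u : psi c * u = 1 -> freeze i c != 0.
Proof.
move/meval_unit; apply: contraNneq => ci0.
by rewrite -(meval_freeze i) /= ci0 meval0.
Qed.

Lemma fractional_prime_chain : exists p : nat -> set A, prime_chain r p.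
Proof.
exists (fun i => fraction_kernel psi (freeze i)); split=> i ir.
  by apply: fraction_kernel_prime => // c u; apply: freeze_unit.
have kerP j x c b : is_fraction psi c b x ->
    fraction_kernel psi (freeze j) x <-> freeze j b = 0.
  by apply: fraction_kernelP => // c' u; apply: freeze_unit.
split=> [x|sub].
  have [c [b fx]] := all_fractional x; rewrite !(kerP _ _ _ _ fx) => b0.
  by rewrite -freeze_freezeS /= b0 rmorph0.
pose k := Ordinal ir; pose d := mpolyX K (mnm1 k) - mpolyC r (v k).
have := sub (psi d);
  rewrite !(kerP _ _ _ _ (is_fraction_image psi d)) /d !rmorphB /=.
rewrite !freezeC !freezeX /= ltnSn ltnn subrr.
move=> /(_ erefl) /(congr1 (mcoeff (mnm1 k))).
rewrite mcoeffB mcoeffX mcoeffC eqxx mcoeff0 mnm1_eq0 mulr0 subr0.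
by move/eqP; rewrite oner_eq0.
Qed.

Lemma fractional_krull_dim : krull_dim_eq A r.
Proof.
by split; [exact: fractional_prime_chain | exact: fractional_prime_chain_le].
Qed.

End FractionsOfPolynomials.

(** * The cube relation *)

HB.instance Definition _ (n : nat) :=
  GRing.isNmodule.Build (multinom n) (@addmA n) (@addmC n) (@add0m n).

Local Notation e := mnm1.

Lemma prodr_exp_mnm1 (n : nat) (K : comPzRingType) (F : 'I_n -> K) (i : 'I_n) :
  \prod_j F j ^+ e i j = F i.
Proof.
rewrite (bigD1 i) //= mnm1E eqxx big1 ?mulr1 // => j /negPf ji.
by rewrite mnm1E eq_sym ji.
Qed.

Section CubeRelation.
Variables (n : nat) (K : pzRingType).

Definition cube_rel (f : multinom n -> K) (I : multinom n) (j k l : 'I_n)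
    : Prop :=
  f (I + e j + e l) * f (I + e k) =
  f I * f (I + e j + e k + e l) + f (I + e j + e k) * f (I + e l) +
  f (I + e k + e l) * f (I + e j).

Lemma cube_rel_mul_top f I j k l : cube_rel f I j k l ->
  f I * f (I + e j + e k + e l) = f (I + e j + e l) * f (I + e k)
    - f (I + e j + e k) * f (I + e l) - f (I + e k + e l) * f (I + e j).
Proof. by move=> ->; rewrite [RHS]addrAC !addrK. Qed.

End CubeRelation.

Section TangentSolution.
Variables (n : nat) (K : numFieldType).
Implicit Types (I : multinom n) (i j k l : 'I_n).

(* tan (atan k - atan j) *)
Definition tan_diff (j k : nat) : K := (k%:R - j%:R) / (1 + j%:R * k%:R).

Definition tan_weight j k : K := if (j < k)%N then tan_diff j k else 1.

Definition tan_solution I : K := \prod_j \prod_k tan_weight j k ^+ (I j * I k).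

Definition tan_ratio i I : K :=
  \prod_k (tan_weight i k * tan_weight k i) ^+ I k.

Lemma tan_denom_neq0 (j k : nat) : 1 + j%:R * k%:R != 0 :> K.
Proof. by rewrite -natrM nat1r pnatr_eq0. Qed.

Lemma tan_diff_neq0 (j k : nat) : (j < k)%N -> tan_diff j k != 0.
Proof.
move=> jk; rewrite mulf_neq0 ?invr_eq0 ?tan_denom_neq0 //.
by rewrite subr_eq0 eqr_nat gtn_eqF.
Qed.

Lemma tan_weight_neq0 j k : tan_weight j k != 0.
Proof.
by rewrite /tan_weight; case: ifP => [/tan_diff_neq0|_] //; rewrite oner_eq0.
Qed.

Lemma tan_weight_sym j k : (j < k)%N ->
  tan_weight j k * tan_weight k j = tan_diff j k /\
  tan_weight k j * tan_weight j k = tan_diff j k.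
Proof. by move=> jk; rewrite /tan_weight jk ltnNge ltnW //= mulr1 mul1r. Qed.

Lemma tan_solution_neq0 I : tan_solution I != 0.
Proof.
by apply/prodf_neq0 => j _; apply/prodf_neq0 => k _;
  rewrite expf_neq0 ?tan_weight_neq0.
Qed.

Lemma tan_solutionDe I i :
  tan_solution (I + e i) = tan_solution I * tan_ratio i I.
Proof.
pose w := tan_weight.
have -> : tan_solution (I + e i) = \prod_j \prod_k
    (w j k ^+ (I j * I k) * (w j k ^+ I k) ^+ e i j *
     (w j k ^+ I j * w j k ^+ e i j) ^+ e i k).
  apply: eq_bigr => j _; apply: eq_bigr => k _; rewrite !mnmDE.
  rewrite -exprD -!exprM -!exprD; congr (_ ^+ _).
  by move: (I j) (I k) (e i j) (e i k) => *; lia.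
transitivity (\prod_j (\prod_k w j k ^+ (I j * I k) *
    (\prod_k w j k ^+ I k) ^+ e i j * (w j i ^+ I j * w j i ^+ e i j))).
  apply: eq_bigr => j _; rewrite !big_split /= prodrXl.
  by rewrite (prodr_exp_mnm1 (fun k => w j k ^+ I j * w j k ^+ e i j)).
rewrite !big_split /= -mulrA; congr (_ * _).
rewrite (prodr_exp_mnm1 (fun j => \prod_k w j k ^+ I k))
  (prodr_exp_mnm1 (w^~ i)).
rewrite {3}/w /tan_weight ltnn mulr1 -big_split /=.
by apply: eq_bigr => k _; rewrite exprMn.
Qed.

Lemma tan_ratioDe i I j :
  tan_ratio i (I + e j) = tan_ratio i I * (tan_weight i j * tan_weight j i).
Proof.
rewrite /tan_ratio; under eq_bigr do rewrite mnmDE exprD.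
by rewrite big_split /=
  (prodr_exp_mnm1 (fun k => tan_weight i k * tan_weight k i)).
Qed.

(* With x = tan (k - j) and y = tan (l - k), tan (l - j) is (x + y) / (1 - x y):
   this is the cube relation divided by its common factor. *)
Lemma tan_solution_cube_rel I j k l : (j < k)%N -> (k < l)%N ->
  cube_rel tan_solution I j k l.
Proof.
move=> jk kl; have jl := ltn_trans jk kl.
have [[[_ Wkj] [_ Wlk]] [_ Wlj]] :=
  (tan_weight_sym jk, tan_weight_sym kl, tan_weight_sym jl).
rewrite /cube_rel !tan_solutionDe !tan_ratioDe !Wkj !Wlk !Wlj.
have addition : tan_diff j l * tan_diff j k * tan_diff k l =
    tan_diff j l - tan_diff j k - tan_diff k l.
  by rewrite /tan_diff; field; rewrite !tan_denom_neq0.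
by ring: addition.
Qed.

End TangentSolution.

Section CubeTop.
Variables (n : nat) (K : fieldType) (f : multinom n -> K).
Implicit Types (I : multinom n) (i j k l : 'I_n).

Definition cube_top I j k l : K :=
  (f (I + e j + e l) * f (I + e k) - f (I + e j + e k) * f (I + e l)
   - f (I + e k + e l) * f (I + e j)) / f I.

Lemma cube_relE I j k l : f I != 0 ->
  cube_rel f I j k l <-> f (I + e j + e k + e l) = cube_top I j k l.
Proof.
move=> fI; rewrite /cube_top /cube_rel; split=> [->|->]; first by field.
by field.
Qed.

Hypothesis f_neq0 : forall I, f I != 0.

Definition pfaffian_rel I i j k l : Prop :=
  f I * f (I + e i + e j + e k + e l) =
  f (I + e i + e j) * f (I + e k + e l) -
  f (I + e i + e k) * f (I + e j + e l) +
  f (I + e i + e l) * f (I + e j + e k).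

Lemma four_cube I i j k l :
  cube_rel f I i j k -> cube_rel f I i j l -> cube_rel f I i k l ->
  cube_rel f I j k l ->
  [/\ cube_rel f (I + e l) i j k <-> pfaffian_rel I i j k l,
      cube_rel f (I + e k) i j l <-> pfaffian_rel I i j k l,
      cube_rel f (I + e j) i k l <-> pfaffian_rel I i j k l &
      cube_rel f (I + e i) j k l <-> pfaffian_rel I i j k l].
Proof.
have fI := f_neq0 I.
move=> /(cube_relE _ _ _ fI) ijk /(cube_relE _ _ _ fI) ijl.
move=> /(cube_relE _ _ _ fI) ikl /(cube_relE _ _ _ fI) jkl.
have proportional (m : 'I_n) lhs rhs pf : f I * (lhs - rhs) =
    - f (I + e m) * (f I * f (I + e i + e j + e k + e l) - pf) ->
    lhs = rhs <-> f I * f (I + e i + e j + e k + e l) = pf.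
  move=> prop; split=> h; apply/eqP; rewrite -subr_eq0; move/eqP: prop.
    by rewrite h subrr mulr0 eq_sym mulf_eq0 oppr_eq0 (negPf (f_neq0 _)).
  by rewrite h subrr mulr0 mulf_eq0 (negPf fI).
rewrite /cube_rel /pfaffian_rel; split.
- rewrite !(addrAC _ (e l)); apply: (proportional l).
  by rewrite ijl ikl jkl /cube_top; field.
- rewrite !(addrAC _ (e k) (e i)) !(addrAC _ (e k) (e j));
  apply: (proportional k).
  by rewrite ijk ikl jkl /cube_top; field.
- rewrite !(addrAC _ (e j) (e i)); apply: (proportional j).
  by rewrite ijk ijl jkl /cube_top; field.
by apply: (proportional i); rewrite ijk ijl ikl /cube_top; field.
Qed.

End CubeTop.

Section SupportSequence.
Variable n : nat.
Implicit Types (I : multinom n) (i j k l : 'I_n).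

Definition supp_seq I : seq 'I_n := [seq i <- enum 'I_n | (0 < I i)%N].

Lemma mem_supp_seq I i : (i \in supp_seq I) = (0 < I i)%N.
Proof. by rewrite mem_filter mem_enum andbT. Qed.

Lemma sorted_supp_seq I : sorted <%O (supp_seq I).
Proof.
apply: lt_sorted_filter.
by have := iota_ltn_sorted 0 n; rewrite -val_enum_ord sorted_map.
Qed.

Lemma supp_seq0 I : mdeg I = 0%N -> supp_seq I = [::].
Proof.
move/eqP; rewrite mdeg_eq0 => /eqP ->; apply/nilP; rewrite /nilp size_filter.
by rewrite -leqn0 leqNgt -has_count; apply/hasPn => i _; rewrite mnm0E.
Qed.

Lemma supp_seq3P I j k l s : supp_seq I = [:: j, k, l & s] ->
  exists I', [/\ (j < k)%N, (k < l)%N & I = I' + e j + e k + e l].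
Proof.
move=> sE; exists (mnm_sub I (e j + e k + e l)).
have := sorted_supp_seq I; rewrite sE /= => /and3P[jk kl _]; split=> //.
rewrite -!addrA (addrA (e j)) -[LHS](@submK _ (e j + e k + e l)) //.
have pos i : i \in [:: j; k; l] -> (0 < I i)%N.
  by rewrite -mem_supp_seq sE !inE => /or3P[]->; rewrite ?orbT.
have [Ij Ik Il] : [/\ 0 < I j, 0 < I k & 0 < I l]%N.
  by split; apply: pos; rewrite !inE eqxx ?orbT.
move: jk kl; rewrite !ltEord => jk kl.
apply/mnm_lepP => i; rewrite !mnmDE !mnm1E.
case: (eqVneq j i) => [<-|_]; first by rewrite -!val_eqE /=; lia.
case: (eqVneq k i) => [<-|_]; first by rewrite -!val_eqE /=; lia.
by case: (eqVneq l i) => [<-|_].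
Qed.

Lemma supp_seq_smallest I j k l : (j < k)%N -> (k < l)%N ->
  (forall i, (i < l)%N -> i \notin [:: j; k] -> I i = 0%N) ->
  exists s, supp_seq (I + e j + e k + e l) = [:: j, k, l & s].
Proof.
move=> jk kl I0; pose J := I + e j + e k + e l.
have JE i : J i = (I i + (j == i) + (k == i) + (l == i))%N.
  by rewrite !mnmDE !mnm1E.
exists [seq i : 'I_n <- supp_seq J | (l < i)%N]; apply: lt_sorted_eq.
- exact: sorted_supp_seq.
- rewrite /= ltEord jk kl /= lt_path_sortedE lt_sorted_filter
  ?sorted_supp_seq //.
  by rewrite andbT; apply/allP => i; rewrite mem_filter => /andP[].
move=> i.
rewrite -/J !inE mem_supp_seq mem_filter mem_supp_seq JE ![i == _]eq_sym.
have [<-|ji] := eqVneq j i; first by lia.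
have [<-|ki] := eqVneq k i; first by lia.
have [<-|li] := eqVneq l i; first by lia.
rewrite !addn0 /=; case: (ltngtP l i) => [//|il|/val_inj/eqP];
  last by rewrite (negPf li).
by rewrite I0 // !inE ![i == _]eq_sym negb_or ji.
Qed.

End SupportSequence.

Section Consistency.
Variables (n : nat) (K : fieldType) (f : multinom n -> K).
Implicit Types (I : multinom n) (i j k l : 'I_n).
Hypothesis f_neq0 : forall I, f I != 0.

(* If m < l also lies in the support of I, the relation at I for j, k, l is by
   four_cube equivalent to the relation at I - e_m + e_l for m, j, k. *)
Lemma cube_rel_consistent :
  (forall I j k l s, supp_seq (I + e j + e k + e l) = [:: j, k, l & s] ->
     cube_rel f I j k l) ->
  forall I j k l, (j < k)%N -> (k < l)%N -> cube_rel f I j k l.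
Proof.
move=> f_rec I j k l.
move: {2}(mdeg I) (erefl (mdeg I)) => d;
  elim/ltn_ind: d I j k l => d IHd I j k l Id.
move: {2}(l : nat) (erefl (l : nat)) => b.
elim/ltn_ind: b I j k l Id => b IHb I j k l Id lb jk kl.
have [m /andP[/andP[ml mjk] Im]|small] :=
    pickP (fun m : 'I_n => (m < l)%N && (m \notin [:: j; k]) && (0 < I m)%N);
    last first.
  have [|s] := supp_seq_smallest jk kl (I := I); last exact: f_rec.
  by move=> i il ijk; have := small i; rewrite il ijk /= lt0n => /negbFE/eqP.
have [I' II'] : exists I', I = I' + e m.
  by exists (mnm_sub I (e m)); rewrite -[LHS](@submK _ (e m)) // lep1mP -lt0n.
subst I; have base (p q r : 'I_n) : (p < q)%N -> (q < r)%N ->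
  cube_rel f I' p q r.
  by apply: (IHd (mdeg I')) => //; rewrite -Id mdegD mdeg1 addn1.
have lower (p q r : 'I_n) :
    (p < q)%N -> (q < r)%N -> (r < l)%N -> cube_rel f (I' + e l) p q r.
  move=> pq qr rl; apply: (IHb r) => //; first by rewrite -lb.
  by rewrite -Id !mdegD !mdeg1.
move: mjk; rewrite !inE negb_or -!val_eqE /= !neq_ltn => /andP[].
move=> /orP[mj _|jm /orP[mk|km]].
- have [top _ _ goal] := four_cube f_neq0 (base m j k mj jk)
    (base m j l mj (ltn_trans jk kl)) (base m k l (ltn_trans mj jk) kl)
      (base j k l jk kl).
  by apply/goal/top/lower.
- have [top _ goal _] := four_cube f_neq0 (base j m k jm mk)
    (base j m l jm (ltn_trans mk kl)) (base j k l jk kl) (base m k l mk kl).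
  by apply/goal/top/lower.
have [top goal _ _] := four_cube f_neq0 (base j k m jk km) (base j k l jk kl)
    (base j m l jm ml) (base k m l km ml).
by apply/goal/top/lower.
Qed.

End Consistency.

Section CubeRecursion.
Variables (n : nat) (K : fieldType).
Implicit Types (I : multinom n) (j k l : 'I_n) (d : multinom n -> K).

Fixpoint cube_rec d (m : nat) I : K :=
  if m isn't m'.+1 then d I else
  if supp_seq I is [:: j, k, l & _] then
    cube_top (cube_rec d m') (mnm_sub I (e j + e k + e l)) j k l
  else d I.

Definition cube_solution d I : K := cube_rec d (mdeg I) I.

Lemma cube_solution_data d I :
  (size (supp_seq I) <= 2)%N -> cube_solution d I = d I.
Proof.
rewrite /cube_solution; case: (mdeg I) => //= m.
by case: (supp_seq I) => [|p [|q [|r t]]].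
Qed.

Lemma eq_cube_top (f g : multinom n -> K) I j k l :
  (forall J, (mdeg J <= mdeg I + 2)%N -> f J = g J) ->
  cube_top f I j k l = cube_top g I j k l.
Proof. by move=> fg; rewrite /cube_top !fg // ?(mdegD, mdeg1); lia. Qed.

Lemma cube_rec_fuel d m m' I : (mdeg I <= m)%N -> (mdeg I <= m')%N ->
  cube_rec d m I = cube_rec d m' I.
Proof.
elim: m m' I => [|m IH] [|m'] I //=.
- by rewrite leqn0 => /eqP/supp_seq0 ->.
- by move=> _; rewrite leqn0 => /eqP/supp_seq0 ->.
case sE : (supp_seq I) => [|j [|k [|l s]]] // Im Im'.
have [I' [_ _ IE]] := supp_seq3P sE; rewrite -addrA -addrA (addrA (e j)) in IE.
rewrite IE in Im Im' *; rewrite addmK; move: Im Im';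
  rewrite !mdegD !mdeg1 => Im Im'.
by apply: eq_cube_top => J Jdeg; apply: IH; lia.
Qed.

Lemma cube_solutionE d I j k l s :
  supp_seq (I + e j + e k + e l) = [:: j, k, l & s] ->
  cube_solution d (I + e j + e k + e l) = cube_top (cube_solution d) I j k l.
Proof.
move=> sE; rewrite {1}/cube_solution.
have -> : mdeg (I + e j + e k + e l) = (mdeg I + 2).+1.
  by rewrite !mdegD !mdeg1; lia.
rewrite /= sE -addrA -addrA (addrA (e j)) addmK.
by apply: eq_cube_top => J Jdeg; apply: cube_rec_fuel.
Qed.

Lemma cube_solution_cube_rel d : (forall I, cube_solution d I != 0) ->
  forall I j k l, (j < k)%N -> (k < l)%N -> cube_rel (cube_solution d) I j k l.
Proof.
move=> d_neq0; apply: cube_rel_consistent => // I j k l s sE.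
by apply/cube_relE => //; apply: cube_solutionE sE.
Qed.

End CubeRecursion.

Section Specialization.
Variables (B : idomainType) (K : fieldType) (ev : {rmorphism B -> K}).
Implicit Types (x y : {fraction B}) (u v : K).

Definition specializes x u : Prop :=
  exists N D, [/\ ev D != 0, x * FracField.tofrac D = FracField.tofrac N
    & ev N = u * ev D].

Lemma specializes_tofrac b : specializes (FracField.tofrac b) (ev b).
Proof. by exists b, 1; rewrite tofrac1 rmorph1 !mulr1 oner_neq0. Qed.

Lemma specializesB x y u v : specializes x u -> specializes y v ->
  specializes (x - y) (u - v).
Proof.
move=> [N [D [D0 xD ND]]] [N' [D' [D'0 yD N'D]]].
exists (N * D' - N' * D), (D * D'); split.
- by rewrite rmorphM mulf_neq0.
- by rewrite rmorphB !rmorphM /= -xD -yD; ring.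
by rewrite rmorphB !rmorphM ND N'D; ring.
Qed.

Lemma specializesM x y u v : specializes x u -> specializes y v ->
  specializes (x * y) (u * v).
Proof.
move=> [N [D [D0 xD ND]]] [N' [D' [D'0 yD N'D]]].
exists (N * N'), (D * D'); split.
- by rewrite rmorphM mulf_neq0.
- by rewrite !rmorphM /= -xD -yD mulrACA.
by rewrite !rmorphM ND N'D mulrACA.
Qed.

Lemma specializes_neq0 x u : specializes x u -> u != 0 -> x != 0.
Proof.
move=> [N [D [D0 xD ND]]]; apply: contraNneq => x0; move/esym/eqP: xD.
rewrite x0 mul0r tofrac_eq0 => /eqP N0; move/esym/eqP: ND.
by rewrite N0 rmorph0 mulf_eq0 (negPf D0) orbF.
Qed.

Lemma specializesV x u : u != 0 -> specializes x u -> specializes x^-1 u^-1.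
Proof.
move=> u0 xu; have x0 := specializes_neq0 xu u0; case: xu => N [D [D0 xD ND]].
exists D, N; split; first by rewrite ND mulf_neq0.
  by rewrite -xD mulKf.
by rewrite ND mulKf.
Qed.

Variables (n : nat) (d : multinom n -> {fraction B}) (s : multinom n -> K).
Hypothesis s_neq0 : forall I, s I != 0.
Hypothesis s_cube_rel : forall I (j k l : 'I_n), (j < k)%N -> (k < l)%N ->
  cube_rel s I j k l.
Hypothesis d_specializes : forall I, (size (supp_seq I) <= 2)%N ->
  specializes (d I) (s I).

Lemma cube_solution_specializes I : specializes (cube_solution d I) (s I).
Proof.
move: {2}(mdeg I) (erefl (mdeg I)) => m; elim/ltn_ind: m I => m IH I Im.
have [small|] := leqP (size (supp_seq I)) 2.
  by rewrite cube_solution_data //; apply: d_specializes.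
case sE : (supp_seq I) => [|j [|k [|l t]]] // _.
have [I' [jk kl IE]] := supp_seq3P sE; subst I.
have spec J : (mdeg J <= mdeg I' + 2)%N ->
    specializes (cube_solution d J) (s J).
  by move=> Jdeg; apply: (IH (mdeg J)) => //; rewrite -Im !mdegD !mdeg1; lia.
have /cube_relE -> // := s_cube_rel I' jk kl; rewrite (cube_solutionE _ sE).
apply: specializesM; last by apply: specializesV => //; apply: spec; lia.
by apply: specializesB; first apply: specializesB; apply: specializesM;
  apply: spec; rewrite !mdegD !mdeg1; lia.
Qed.

Lemma cube_solution_neq0 I : cube_solution d I != 0.
Proof. exact: specializes_neq0 (cube_solution_specializes I) (s_neq0 I). Qed.

End Specialization.

Section GenericSolution.
Variables (n r : nat) (K : numFieldType) (V : 'I_r -> multinom n).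
Hypothesis V_inj : injective V.
Hypothesis V_supp : forall i, (size (supp_seq (V i)) <= 2)%N.

Lemma generic_cube_solution : exists f : multinom n -> {fraction mpoly r K},
  [/\ forall I, f I != 0,
      forall I (j k l : 'I_n), (j < k)%N -> (k < l)%N -> cube_rel f I j k l &
      forall i, f (V i) = FracField.tofrac (mpolyX K (mnm1 i))].
Proof.
pose data I : mpoly r K :=
  if [pick i | V i == I] is Some i then mpolyX K (mnm1 i)
  else mpolyC r (tan_solution K I).
have dataV i : data (V i) = mpolyX K (mnm1 i).
  rewrite /data; case: pickP => [j /eqP/V_inj ->|/(_ i)] //.
  by rewrite eqxx.
pose ev := meval (tan_solution K \o V) : {rmorphism mpoly r K -> K}.
have ev_data I : ev (data I) = tan_solution K I.
  by rewrite /data /ev /=; case: pickP => [i /eqP <-|_];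
    rewrite ?mevalXU ?mevalC.
pose d I := FracField.tofrac (data I).
have d_specializes I : (size (supp_seq I) <= 2)%N ->
    specializes ev (d I) (tan_solution K I).
  by move=> _; rewrite -ev_data; exact: specializes_tofrac.
have d_neq0 := cube_solution_neq0 (tan_solution_neq0 K)
  (tan_solution_cube_rel K) d_specializes.
exists (cube_solution d); split=> //; first exact: cube_solution_cube_rel.
by move=> i; rewrite cube_solution_data // /d dataV.
Qed.

End GenericSolution.

(** * Words, paths and the exchange argument *)

Section Box.
Variables (n : nat) (a : 'I_n -> nat).
Implicit Types (I J : multinom n).

Definition box_top : multinom n := Multinom [tuple a i | i < n].

Definition in_box I : bool := lem I box_top.

Lemma in_boxP I : reflect (forall i, (I i <= a i)%N) (in_box I).
Proof.
by apply: (iffP mnm_lepP) => Ia i; have := Ia i; rewrite mnmE.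
Qed.

Lemma in_boxDl I J : in_box (I + J) -> in_box I.
Proof. exact/lepm_trans/lem_addr. Qed.

End Box.

Section Words.
Variable n : nat.
Notation word := (seq 'I_n).
Implicit Types (I : multinom n) (i j k l : 'I_n) (u w s t : word).

Definition endpoint w : multinom n := \sum_(i <- w) e i.

Lemma endpointE w i : endpoint w i = count_mem i w.
Proof.
rewrite /endpoint mnm_sumE -sum1_count [RHS]big_mkcond /=.
by apply: eq_bigr => j _; rewrite mnm1E; case: eqP.
Qed.

Lemma endpoint_nil : endpoint [::] = 0.
Proof. exact: big_nil. Qed.

Lemma endpoint_cat u w : endpoint (u ++ w) = endpoint u + endpoint w.
Proof. exact: big_cat. Qed.

Lemma endpoint_rcons u i : endpoint (rcons u i) = endpoint u + e i.
Proof. by rewrite -cats1 endpoint_cat /endpoint big_seq1. Qed.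

Lemma endpoint_cons i w : endpoint (i :: w) = e i + endpoint w.
Proof. exact: big_cons. Qed.

Lemma endpoint_perm u w : perm_eq u w -> endpoint u = endpoint w.
Proof. exact: perm_big. Qed.

Lemma perm_swap u i j t : perm_eq (u ++ i :: j :: t) (u ++ j :: i :: t).
Proof.
by rewrite perm_cat2l -[i :: j :: t]/([:: i] ++ [:: j] ++ t) perm_catCA.
Qed.

Lemma endpoint_swap u i j t :
  endpoint (u ++ i :: j :: t) = endpoint (u ++ j :: i :: t).
Proof. exact/endpoint_perm/perm_swap. Qed.

Fixpoint vertices I w : seq (multinom n) :=
  I :: if w is i :: w' then vertices (I + e i) w' else [::].

Lemma size_vertices I w : size (vertices I w) = (size w).+1.
Proof. by elim: w I => [|i w IH] I //=; rewrite IH. Qed.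

Lemma verticesP I w v :
  reflect (exists u t, w = u ++ t /\ v = I + endpoint u) (v \in vertices I w).
Proof.
apply: (iffP idP) => [|[u [t [-> ->]]]].
  elim: w I => [|i w IH] I /=.
    by rewrite inE => /eqP ->; exists [::], [::]; rewrite endpoint_nil addr0.
  rewrite inE => /orP[/eqP ->|/IH[u [t [-> ->]]]].
    by exists [::], (i :: w); rewrite endpoint_nil addr0.
  by exists (i :: u), t; rewrite endpoint_cons addrA.
elim: u I => [|i u IH] I.
  by rewrite endpoint_nil addr0; case: t => *; exact: mem_head.
by rewrite /= inE endpoint_cons addrA IH orbT.
Qed.

Lemma mem_vertices_cat I u t v : (v \in vertices I (u ++ t)) =
  (v \in vertices I u) || (v \in vertices (I + endpoint u) t).
Proof.
elim: u I => [|i u IH] I /=; last by rewrite !inE IH endpoint_cons addrA orbA.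
by rewrite endpoint_nil addr0 inE; case: t => [|j t] /=;
  rewrite !inE ?orbF ?orbb ?orbA ?orbb.
Qed.

Fixpoint edges I w : seq (multinom n * 'I_n) :=
  if w is i :: w' then (I, i) :: edges (I + e i) w' else [::].

Lemma edges_cat I u t :
  edges I (u ++ t) = edges I u ++ edges (I + endpoint u) t.
Proof.
by elim: u I => [|i u IH] I /=;
  rewrite ?IH ?endpoint_cons ?addrA // endpoint_nil addr0.
Qed.

Lemma mem_edges I w J i : (J, i) \in edges I w ->
  exists u t, w = u ++ i :: t /\ J = I + endpoint u.
Proof.
elim: w I => [|k w IH] I //=;
  rewrite inE => /orP[/eqP[-> ->]|/IH[u [t [-> ->]]]].
  by exists [::], w; rewrite endpoint_nil addr0.
by exists (k :: u), t; rewrite endpoint_cons addrA.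
Qed.

Fixpoint ordered_pairs (r : rel 'I_n) w : nat :=
  if w is i :: w' then (count (r i) w' + ordered_pairs r w')%N else 0%N.

Lemma ordered_pairs_cat_perm r u s t : perm_eq s t ->
  (ordered_pairs r (u ++ s) + ordered_pairs r t =
   ordered_pairs r (u ++ t) + ordered_pairs r s)%N.
Proof.
move=> st; elim: u => [|i u IH] /=; first by rewrite addnC.
have /permP -> : perm_eq (u ++ s) (u ++ t) by rewrite perm_cat2l.
by rewrite -!addnA IH.
Qed.

Lemma ordered_pairs_swap (r : rel 'I_n) u i j t : r i j -> ~~ r j i ->
  ordered_pairs r (u ++ i :: j :: t) = (ordered_pairs r (u ++ j :: i :: t)).+1.
Proof.
move=> ij ji; have := ordered_pairs_cat_perm r u (perm_swap [::] i j t).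
by rewrite /= ij (negPf ji); lia.
Qed.

Lemma ascents_swap u i j t : (i < j)%N ->
  ordered_pairs <%O (u ++ i :: j :: t) =
    (ordered_pairs <%O (u ++ j :: i :: t)).+1.
Proof.
by move=> ij; apply: ordered_pairs_swap; rewrite ltEord // -leqNgt ltnW.
Qed.

Lemma descents_swap u i j t : (i < j)%N ->
  ordered_pairs >%O (u ++ j :: i :: t) =
    (ordered_pairs >%O (u ++ i :: j :: t)).+1.
Proof.
by move=> ij; apply: ordered_pairs_swap; rewrite /= ltEord // -leqNgt ltnW.
Qed.

Lemma sortedPn_adjacent (r : rel 'I_n) w : ~~ sorted r w ->
  exists u i j t, w = u ++ i :: j :: t /\ ~~ r i j.
Proof.
elim: w => [|i [|j w] IH] //=; have [ij|ij _] := boolP (r i j).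
  by move=> /IH[u [i' [j' [t [-> nr]]]]]; exists (i :: u), i', j', t.
by exists [::], i, j, w.
Qed.

Lemma eq_two_letter_split u1 u2 t1 t2 i1 j1 i2 j2 :
  u1 ++ i1 :: j1 :: t1 = u2 ++ i2 :: j2 :: t2 ->
  [\/ [/\ u1 = u2, i1 = i2, j1 = j2 & t1 = t2],
      exists v, u2 = u1 ++ i1 :: j1 :: v /\ t1 = v ++ i2 :: j2 :: t2,
      exists v, u1 = u2 ++ i2 :: j2 :: v /\ t2 = v ++ i1 :: j1 :: t1 |
      [/\ u2 = rcons u1 i1, j1 = i2 & t1 = j2 :: t2] \/
      [/\ u1 = rcons u2 i2, j2 = i1 & t2 = j1 :: t1]].
Proof.
elim: u1 u2 => [|x1 u1 IH] [|x2 u2] /=.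
- by case=> -> -> ->; constructor 1.
- case=> <-; case: u2 => [|y u2] /= [-> ->]; first by constructor 4; left.
  by constructor 2; exists u2.
- case=> ->; case: u1 IH => [|y u1] IH /= [-> <-];
  first by constructor 4; right.
  by constructor 3; exists u1.
case=> -> /IH[[-> -> -> ->]|[v [-> ->]]|[v [-> ->]]|[[-> -> ->]|[-> -> ->]]].
- by constructor 1.
- by constructor 2; exists v.
- by constructor 3; exists v.
- by constructor 4; left.
by constructor 4; right.
Qed.

Definition sorted_word I : word :=
  sort <=%O (flatten [seq nseq (I i) i | i <- enum 'I_n]).

Lemma count_sorted_word I i : count_mem i (sorted_word I) = I i.
Proof.
rewrite /sorted_word (permP (permEl (perm_sort _ _))) count_flatten -map_comp.
rewrite sumnE big_map big_enum /= (bigD1 i) //= count_nseq /= eqxx mul1n.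
by rewrite big1 ?addn0 // => j /negPf ji; rewrite count_nseq /= ji.
Qed.

Lemma endpoint_sorted_word I : endpoint (sorted_word I) = I.
Proof. by apply/mnmP=> i; rewrite endpointE count_sorted_word. Qed.

Lemma sorted_sorted_word I : sorted <=%O (sorted_word I).
Proof. exact: sort_le_sorted. Qed.

Lemma eq_endpoint_perm u w : endpoint u = endpoint w -> perm_eq u w.
Proof. by move=> uw; apply/allP => i _ /=; rewrite -!endpointE uw. Qed.

End Words.

Section Sweepable.
Variables (n : nat) (a : 'I_n -> nat) (M : multinom n -> Prop).
Notation word := (seq 'I_n).
Implicit Types (I J : multinom n) (i j k l : 'I_n) (u v w t : word).

Definition flip_closed : Prop :=
  forall I j k l, (j < k)%N -> (k < l)%N -> in_box a (I + e j + e k + e l) ->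
  M I -> M (I + e j) -> M (I + e l) -> M (I + e j + e k) -> M (I + e k + e l) ->
  M (I + e j + e k + e l) -> M (I + e k) <-> M (I + e j + e l).

Definition known I w : Prop := forall J, J \in vertices I w -> M J.

Lemma known_cat I u w :
  known I (u ++ w) <-> known I u /\ known (I + endpoint u) w.
Proof.
split=> [uwM|[uM wM] v]; last by rewrite mem_vertices_cat => /orP[/uM|/wM].
by split=> v vw; apply: uwM; rewrite mem_vertices_cat vw ?orbT.
Qed.

Lemma known_cons I i w : known I (i :: w) <-> M I /\ known (I + e i) w.
Proof.
split=> [iwM|[IM wM] v]; last by rewrite /= inE => /orP[/eqP->|/wM].
by split=> [|v vw]; apply: iwM; rewrite /= inE ?eqxx ?vw ?orbT.
Qed.

Lemma known_head I w : known I w -> M I.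
Proof. by apply; case: w => [|i w]; rewrite /= mem_head. Qed.

Lemma known_prefix u w : known 0 (u ++ w) -> M (endpoint u).
Proof. by rewrite known_cat add0r => -[_ /known_head]. Qed.

Lemma known_swap u i j t :
  known 0 (u ++ i :: j :: t) -> M (endpoint u + e j) ->
  known 0 (u ++ j :: i :: t).
Proof.
rewrite !known_cat !known_cons !add0r (addrAC _ (e i)) => -[uM [vM [_ tM]]] jM.
by split.
Qed.

Inductive sweepable : word -> Prop :=
| sweepable_sorted w : known 0 w -> sorted >=%O w -> sweepable w
| sweepable_swap u i j t : (i < j)%N -> known 0 (u ++ i :: j :: t) ->
    sweepable (u ++ j :: i :: t) -> sweepable (u ++ i :: j :: t).

Lemma sweepable_known w : sweepable w -> known 0 w.
Proof. by case. Qed.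

Lemma sweepable_disjoint_left u i j v k l t : (i < j)%N -> (k < l)%N ->
  known 0 (u ++ i :: j :: v ++ k :: l :: t) ->
  sweepable (u ++ j :: i :: v ++ l :: k :: t) ->
  sweepable (u ++ j :: i :: v ++ k :: l :: t).
Proof.
move=> ij kl wM sw; rewrite -/([:: j, i & v] ++ k :: l :: t) catA;
  apply: sweepable_swap => //.
  rewrite -catA /=; apply: known_swap wM _; rewrite -endpoint_rcons.
  by apply: (known_prefix (w := i :: v ++ l :: k :: t)); rewrite cat_rcons;
    exact: sweepable_known.
by rewrite -catA.
Qed.

Lemma sweepable_disjoint_right u i j v k l t : (i < j)%N -> (k < l)%N ->
  known 0 (u ++ i :: j :: v ++ k :: l :: t) ->
  sweepable (u ++ j :: i :: v ++ l :: k :: t) ->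
  sweepable (u ++ i :: j :: v ++ l :: k :: t).
Proof.
move=> ij kl wM sw; apply: sweepable_swap => //.
rewrite -/([:: i, j & v] ++ l :: k :: t) catA; apply: known_swap.
  by rewrite -catA.
rewrite endpoint_swap -endpoint_rcons; apply: (known_prefix (w := k :: t)).
by rewrite cat_rcons -catA; exact: sweepable_known.
Qed.

Lemma known3 u i j k t : known 0 (u ++ i :: j :: k :: t) ->
  [/\ M (endpoint u), M (endpoint u + e i), M (endpoint u + e i + e j)
    & M (endpoint u + e i + e j + e k)].
Proof.
by rewrite known_cat !known_cons add0r => -[_ [uM [iM [jM /known_head kM]]]].
Qed.

Section Braid.
Hypothesis M_flip : flip_closed.
Variables (u t : word) (i j k : 'I_n).
Hypotheses (ij : (i < j)%N) (jk : (j < k)%N).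
Hypothesis uijkt_box : in_box a (endpoint (u ++ i :: j :: k :: t)).
Hypothesis ijk_known : known 0 (u ++ i :: j :: k :: t).
Hypothesis kji_sweepable : sweepable (u ++ k :: j :: i :: t).

Lemma braid_flip : M (endpoint u + e j) <-> M (endpoint u + e i + e k).
Proof.
have [uM iM ijM ijkM] := known3 ijk_known.
have [_ kM kjM _] := known3 (sweepable_known kji_sweepable).
apply: M_flip => //; last by rewrite addrAC.
apply: in_boxDl (endpoint t) _.
by move: uijkt_box; rewrite endpoint_cat !endpoint_cons !addrA.
Qed.

Lemma sweepable_braid_left :
  M (endpoint u + e i + e k) -> sweepable (u ++ j :: i :: k :: t).
Proof.
move/braid_flip => jM; have jik_known := known_swap ijk_known jM.
have [_ _ kjM _] := known3 (sweepable_known kji_sweepable).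
have jki_sweepable : sweepable (u ++ j :: k :: i :: t).
  apply: sweepable_swap => //; rewrite -cat_rcons; apply: known_swap.
    by rewrite cat_rcons.
  by rewrite endpoint_rcons addrAC.
rewrite -cat_rcons; apply: sweepable_swap; first exact: ltn_trans jk.
  by rewrite cat_rcons.
by rewrite cat_rcons.
Qed.

Lemma sweepable_braid_right :
  M (endpoint u + e j) -> sweepable (u ++ i :: k :: j :: t).
Proof.
move/braid_flip => ikM.
have ikj_known : known 0 (u ++ i :: k :: j :: t).
  by rewrite -cat_rcons; apply: known_swap;
    rewrite ?cat_rcons // endpoint_rcons.
have [_ kM _ _] := known3 (sweepable_known kji_sweepable).
apply: sweepable_swap => //; first exact: ltn_trans jk.
rewrite -cat_rcons; apply: sweepable_swap; rewrite ?cat_rcons //.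
exact: known_swap ikj_known kM.
Qed.

End Braid.

Definition swappable_below (N : nat) I : Prop := forall u i j t, (i < j)%N ->
  endpoint (u ++ i :: j :: t) = I ->
  (ordered_pairs <%O (u ++ i :: j :: t) < N)%N ->
  sweepable (u ++ i :: j :: t) -> sweepable (u ++ j :: i :: t).

Section Overlap.
Hypothesis M_flip : flip_closed.
Variables (u t : word) (i j k : 'I_n).
Hypotheses (ij : (i < j)%N) (jk : (j < k)%N).
Let w := u ++ i :: j :: k :: t.
Hypothesis w_box : in_box a (endpoint w).
Hypothesis w_known : known 0 w.
Hypothesis w_swappable : swappable_below (ordered_pairs <%O w) (endpoint w).

Let ik : (i < k)%N. Proof. exact: ltn_trans jk. Qed.

Lemma sweepable_overlap_left :
  sweepable (u ++ i :: k :: j :: t) -> sweepable (u ++ j :: i :: k :: t).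
Proof.
move=> ikj_sweepable.
have [_ _ ikM _] := known3 (sweepable_known ikj_sweepable).
have ends := endpoint_swap (rcons u i) j k t; rewrite !cat_rcons in ends.
have pairs := ascents_swap (rcons u i) t jk; rewrite !cat_rcons in pairs.
apply: (sweepable_braid_left M_flip) => //.
rewrite -cat_rcons; apply: w_swappable => //; rewrite cat_rcons.
- by rewrite /w ends -endpoint_swap.
- by rewrite /w pairs (ascents_swap _ _ ik); lia.
by apply: w_swappable => //; rewrite /w pairs.
Qed.

Lemma sweepable_overlap_right :
  sweepable (u ++ j :: i :: k :: t) -> sweepable (u ++ i :: k :: j :: t).
Proof.
move=> jik_sweepable; have [_ jM _ _] := known3 (sweepable_known jik_sweepable).
have ends := endpoint_swap (rcons u j) i k t; rewrite !cat_rcons in ends.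
have pairs := ascents_swap (rcons u j) t ik; rewrite !cat_rcons in pairs.
apply: (sweepable_braid_right M_flip) => //; apply: w_swappable => //.
- by rewrite -ends -endpoint_swap.
- by rewrite /w (ascents_swap _ _ ij) pairs; lia.
rewrite -cat_rcons; apply: w_swappable; rewrite ?cat_rcons //.
- exact: endpoint_swap.
by rewrite /w (ascents_swap _ _ ij).
Qed.

End Overlap.

(* Exchange argument of Matsumoto's theorem: swaps at disjoint places are
   exchanged freely, and a braid i j k -> k j i is exactly one cube flip. *)
Lemma sweepable_swap_any u i j t : flip_closed -> (i < j)%N ->
  in_box a (endpoint (u ++ i :: j :: t)) ->
  sweepable (u ++ i :: j :: t) -> sweepable (u ++ j :: i :: t).
Proof.
move=> M_flip; move: {2}(ordered_pairs _ _)
  (erefl (ordered_pairs <%O (u ++ i :: j :: t))) => N.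
elim/ltn_ind: N u i j t => N IHN u i j t wN ij w_box w_sweepable.
have w_swappable : swappable_below (ordered_pairs <%O (u ++ i :: j :: t))
    (endpoint (u ++ i :: j :: t)).
  rewrite wN => u' i' j' t' ij' wE wN' sw.
  by apply: IHN wN' _ _ _ _ erefl ij' _ sw; rewrite wE.
have w_known := sweepable_known w_sweepable.
case: {-1}_ / w_sweepable (erefl (u ++ i :: j :: t)) =>
  [w _ w_sorted wE|u' i' j' t' ij' _ sw wE].
  move: w_sorted; rewrite -wE => /(cat_sorted2 (s := u)) [_ /=].
  by rewrite leEord leqNgt ij.
case: (eq_two_letter_split wE) =>
  [[-> -> -> ->] //|[v [uE tE]]|[v [uE tE]]|[] [uE lE tE]].
- subst u' t; rewrite -!catA /= in sw; apply: sweepable_disjoint_left => //.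
  apply: w_swappable => //.
    by have := endpoint_swap (u ++ i :: j :: v) i' j' t';
      rewrite -!catA /= => ->.
  by have := ascents_swap (u ++ i :: j :: v) t' ij'; rewrite -!catA /= => ->.
- subst u t'; rewrite -!catA /= in w_known w_swappable sw *.
  apply: sweepable_disjoint_right => //.
  rewrite -/([:: j', i' & v] ++ j :: i :: t) catA; apply: w_swappable => //;
    rewrite -catA //=.
    exact: endpoint_swap.
  by rewrite (ascents_swap _ _ ij').
- by subst u' i' t; rewrite cat_rcons in sw; apply: sweepable_overlap_left.
by subst u j' t'; rewrite !cat_rcons in w_known w_box w_swappable *;
  apply: sweepable_overlap_right.
Qed.

Lemma sweepable_perm w w' : flip_closed -> in_box a (endpoint w) ->
  sorted <=%O w -> sweepable w -> perm_eq w w' -> sweepable w'.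
Proof.
move=> M_flip w_box w_sorted sw.
move: {2}(ordered_pairs _ _) (erefl (ordered_pairs >%O w')) => N.
elim/ltn_ind: N w' => N IH w' wN ww'.
have [w'_sorted|] := boolP (sorted <=%O w');
  first by rewrite -(le_sorted_eq w_sorted w'_sorted ww').
move=> /sortedPn_adjacent[u [j [i [t [w'E]]]]].
rewrite -ltNge ltEord => ij; subst w'.
have wij := perm_trans ww' (perm_swap u j i t).
apply: sweepable_swap_any => //; first by rewrite -(endpoint_perm wij).
by apply: IH erefl wij; rewrite -wN (descents_swap _ _ ij).
Qed.

Lemma sweepable_box_known :
  flip_closed -> sweepable (sorted_word (box_top a)) ->
  forall I, in_box a I -> M I.
Proof.
move=> M_flip sw I I_box.
suff /sweepable_known/known_prefix :
    sweepable (sorted_word I ++ sorted_word (mnm_sub (box_top a) I)).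
  by rewrite endpoint_sorted_word.
apply: sweepable_perm M_flip _ (sorted_sorted_word _) sw _.
  by rewrite endpoint_sorted_word /in_box lepm_refl.
apply: eq_endpoint_perm; rewrite endpoint_cat !endpoint_sorted_word addrC.
exact/esym/submK.
Qed.

End Sweepable.

(** * Sweeping a tiling *)

Lemma first_exit (T : Type) (P : pred (seq T)) s : P [::] -> ~~ P s ->
  exists s1 x s2, [/\ s = s1 ++ x :: s2, P s1 & ~~ P (rcons s1 x)].
Proof.
move=> P0; elim/last_ind: s => [|s x IH]; first by rewrite P0.
have [Ps nPs|/IH[s1 [y [s2 [-> Ps1 nPs1]]]] _] := boolP (P s).
  by exists s, x, [::]; rewrite cats1.
by exists s1, y, (rcons s2 x); rewrite rcons_cat.
Qed.

Section Ascents.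
Variable n : nat.
Implicit Type w : seq 'I_n.

Lemma sum_count_size w : (\sum_(i < n) count_mem i w = size w)%N.
Proof.
under eq_bigr do rewrite -endpointE; rewrite -mdegE mdeg_sum.
by under eq_bigr do rewrite mdeg1; rewrite sum1_size.
Qed.

Lemma ascents_le w : (ordered_pairs <%O w <=
  \sum_(i < n) \sum_(j < n | i < j) count_mem i w * count_mem j w)%N.
Proof.
elim: w => [|x w IH] //=.
have -> : count (> x)%O w = (\sum_(j < n | x < j) count_mem j w)%N.
  rewrite -sum1_count (partition_big id (fun j : 'I_n => x < j)%N) //=.
  apply: eq_bigr => j xj; rewrite sum1_count; apply: eq_count => y /=.
  by rewrite ltEord andbC; case: eqP => [->|//]; rewrite xj.
apply: leq_trans (_ :
  \sum_(i < n) ((x == i) * (\sum_(j < n | i < j) count_mem j w)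
   + \sum_(j < n | i < j) count_mem i w * count_mem j w) <= _)%N.
  by rewrite big_split /= leq_add // [leqRHS](bigD1 x) //= eqxx mul1n leq_addr.
apply: leq_sum => i _; rewrite big_distrr -big_split /=; apply: leq_sum => j ij.
by rewrite -mulnDl leq_mul // leq_addl.
Qed.

Lemma ascents_sorted w : sorted >=%O w -> ordered_pairs <%O w = 0%N.
Proof.
elim: w => [|x w IH] //= xw; rewrite IH ?(path_sorted xw) // addn0.
apply/eqP; rewrite -leqn0 leqNgt -has_count; apply/hasPn => y yw.
move: xw; rewrite (path_sortedE ge_trans) => /andP[/allP/(_ y yw) /= yx _].
by rewrite -leNgt.
Qed.

End Ascents.

(* F I i k is meant for i < k: its right vertex is then I + e_i and its left
   vertex I + e_k, since the directions turn counterclockwise with the index. *)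
Record tile_complex (n : nat) (a : 'I_n -> nat) (V : multinom n -> Prop)
    (E : multinom n -> 'I_n -> Prop)
    (F : multinom n -> 'I_n -> 'I_n -> Prop) : Prop := {
  origin_vertex : V 0;
  vertex_box : forall I : multinom n, V I -> in_box a I;
  tile_box : forall (I : multinom n) (i k : 'I_n), (i < k)%N -> F I i k ->
    in_box a (I + e i + e k);
  edge_vertices : forall (I : multinom n) (i : 'I_n),
    E I i -> V I /\ V (I + e i);
  tile_edges : forall (I : multinom n) (i k : 'I_n), (i < k)%N -> F I i k ->
    [/\ E I i, E I k & E (I + e k) i];
  edge_left_tile : forall (I : multinom n) (i k : 'I_n), E I i ->
    ((i < k)%N && (I k < a k)%N) || ((k < i)%N && (0 < I k)%N) ->
    (exists2 k' : 'I_n, (i < k')%N & F I i k') \/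
    (exists (I' : multinom n) (k' : 'I_n),
      [/\ (k' < i)%N, I = I' + e k' & F I' k' i]);
  tile_right_vertex_inj : forall (I I' : multinom n) (i k i' k' : 'I_n),
    (i < k)%N -> (i' < k')%N ->
    F I i k -> F I' i' k' -> I + e i = I' + e i' ->
    [/\ I = I', i = i' & k = k'];
  left_vertex_tile : forall (v : multinom n) (i k : 'I_n),
    V v -> (i < k)%N -> (v i < a i)%N -> (0 < v k)%N ->
    exists (I : multinom n) (i' k' : 'I_n),
      [/\ (i' < k')%N, F I i' k' & v = I + e k'];
  right_boundary_edge : forall (I : multinom n) (i : 'I_n),
    in_box a I -> (I i < a i)%N ->
    (forall k : 'I_n, (k < i)%N -> I k = a k) ->
    (forall k : 'I_n, (i < k)%N -> I k = 0%N) -> E I i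
}.

Section Sweeps.
Variables (n : nat) (a : 'I_n -> nat) (V : multinom n -> Prop).
Variables (E : multinom n -> 'I_n -> Prop)
    (F : multinom n -> 'I_n -> 'I_n -> Prop).
Hypothesis tiled : tile_complex a V E F.
Notation word := (seq 'I_n).
Implicit Types (I v : multinom n) (i j k x y : 'I_n) (u w t : word).

Definition path_in w : Prop := forall c, c \in edges 0 w -> E c.1 c.2.

Definition full w : Prop := endpoint w = box_top a.

Definition left_boundary v : bool :=
  [forall k : 'I_n, forall i : 'I_n,
    (k < i)%N && (0 < v k)%N ==> (a i <= v i)%N].

Lemma left_boundaryPn v :
  reflect (exists k i, [/\ (k < i)%N, (0 < v k)%N & (v i < a i)%N])
    (~~ left_boundary v).
Proof.
apply: (iffP forallPn) => [[k nk]|[k [i [ki vk vi]]]].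
  case/forallPn: nk => i; rewrite negb_imply -ltnNge => /andP[/andP[ki vk] vi].
  by exists k, i.
by exists k; apply/forallPn; exists i; rewrite ki vk -ltnNge.
Qed.

Lemma full_count w i : full w -> count_mem i w = a i.
Proof. by move=> fw; rewrite -endpointE fw mnmE. Qed.

Lemma full_swap u i j t : full (u ++ i :: j :: t) -> full (u ++ j :: i :: t).
Proof. by rewrite /full endpoint_swap. Qed.

Lemma full_letter_lt u i t : full (u ++ i :: t) -> (endpoint u i < a i)%N.
Proof.
move=> fw; rewrite -(full_count i fw) endpointE count_cat /= eqxx.
by rewrite -[X in (X < _)%N]addn0 ltn_add2l.
Qed.

Lemma path_in_edge u i t : path_in (u ++ i :: t) -> E (endpoint u) i.
Proof.
by move=> pw; apply: (pw (endpoint u, i));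
  rewrite edges_cat add0r mem_cat inE eqxx orbT.
Qed.

Lemma tile_right_vertex_not_left_boundary I i k : (i < k)%N -> F I i k ->
  ~~ left_boundary (I + e i).
Proof.
move=> ik tik; apply/left_boundaryPn; exists i, k; split=> //.
  by rewrite mnmDE mnm1E eqxx addn1.
by have /in_boxP/(_ k) := tile_box tiled ik tik;
  rewrite !mnmDE !mnm1E eqxx addn1.
Qed.

Lemma nonboundary_edge_left_tile I i : E I i ->
  ~~ left_boundary I || ~~ left_boundary (I + e i) ->
  (exists2 k : 'I_n, (i < k)%N & F I i k) \/
  (exists I' (k : 'I_n), [/\ (k < i)%N, I = I' + e k & F I' k i]).
Proof.
move=> eIi nb; have eq_off j : j != i -> (I + e i) j = I j.
  by move=> /negPf ji; rewrite mnmDE mnm1E eq_sym ji addn0.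
suff [k side] : exists k : 'I_n,
    ((i < k)%N && (I k < a k)%N) || ((k < i)%N && (0 < I k)%N).
  exact: (edge_left_tile tiled eIi side).
case/orP: nb => /left_boundaryPn[k1 [i1 [ki k1_gt0 i1_lt]]].
  have [lt|ge] := ltnP i i1; first by exists i1; rewrite lt i1_lt.
  by exists k1; rewrite (leq_trans ki ge) k1_gt0 orbT.
have [lt|ge] := ltnP i i1.
  by exists i1; rewrite lt -eq_off ?i1_lt // -val_eqE /= gtn_eqF.
have lt : (k1 < i)%N by exact: leq_trans ki ge.
by exists k1; rewrite lt -eq_off ?k1_gt0 ?orbT // -val_eqE /= ltn_eqF.
Qed.

Definition adjacent_tile w : Prop :=
  exists u i j t, [/\ (i < j)%N, w = u ++ i :: j :: t & F (endpoint u) i j].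

(* The path leaves the right vertex of each tile to its left along an edge,
   whose left tile is either the same tile or starts with that edge. *)
Lemma forward_tile u x k t : full (u ++ x :: t) -> path_in (u ++ x :: t) ->
  (x < k)%N -> F (endpoint u) x k -> adjacent_tile (u ++ x :: t).
Proof.
elim: t u x k => [|y t IH] u x k fw pw xk txk.
  have /in_boxP/(_ k) := tile_box tiled xk txk.
  by rewrite -endpoint_rcons -cats1 fw mnmDE mnm1E eqxx !mnmE addn1 ltnn.
have fw' := fw; have pw' := pw; rewrite -cat_rcons in fw' pw'.
have := path_in_edge pw'; rewrite endpoint_rcons => edge_y.
case: (nonboundary_edge_left_tile edge_y).
- by rewrite (tile_right_vertex_not_left_boundary xk txk).
- by rewrite -endpoint_rcons -cat_rcons => -[k' yk' tyk'];
  apply: IH fw' pw' yk' tyk'.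
move=> [I' [m [my vE tmy]]].
have [_ _ ky] := tile_right_vertex_inj tiled xk my txk tmy vE; subst k.
by exists u, x, y, t.
Qed.

Lemma find_tile w : full w -> path_in w -> ~~ sorted >=%O w -> adjacent_tile w.
Proof.
move=> fw pw /sortedPn_adjacent[u [i [j [t [wE]]]]].
rewrite /= leEord -ltnNge => ij.
have origin_boundary : left_boundary (endpoint [::] : multinom n).
  apply/forallP => k; apply/forallP => l; rewrite endpointE andbF; exact/implyP.
have exit : ~~ left_boundary (endpoint (rcons u i)).
  apply/left_boundaryPn; exists i, j; split=> //.
    by rewrite endpoint_rcons mnmDE mnm1E eqxx addn1.
  by apply: (@full_letter_lt _ _ t); rewrite cat_rcons -wE.
have [u' [x [t' [uE boundary nonboundary]]]] :=
  first_exit (P := left_boundary \o @endpoint n) origin_boundary exit.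
have wE' : w = u' ++ x :: t' ++ j :: t by rewrite wE -cat_rcons uE -catA.
rewrite wE' in fw pw *; have edge_x := path_in_edge pw.
case: (nonboundary_edge_left_tile edge_x).
- by rewrite -endpoint_rcons nonboundary orbT.
- by move=> [k xk txk]; apply: forward_tile txk.
move=> [I' [m [mx vE tmx]]].
have := tile_right_vertex_not_left_boundary mx tmx.
by rewrite -vE => /negP[].
Qed.

Inductive sweep : word -> seq (multinom n) -> Prop :=
| sweep_sorted w : sorted >=%O w -> sweep w (vertices 0 w)
| sweep_tile u i j t L : (i < j)%N -> F (endpoint u) i j ->
    sweep (u ++ j :: i :: t) L ->
    sweep (u ++ i :: j :: t) (endpoint u + e i :: L).

Lemma path_in_vertices w v : path_in w -> v \in vertices 0 w -> V v.
Proof.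
move=> pw /verticesP[u [t [wE ->]]]; rewrite add0r.
case/lastP: u => [|u i] in wE *.
  by rewrite endpoint_nil; exact: origin_vertex tiled.
rewrite endpoint_rcons; rewrite wE cat_rcons in pw.
by have [] := edge_vertices tiled (path_in_edge pw).
Qed.

Lemma path_in_swap u i j t : (i < j)%N -> F (endpoint u) i j ->
  path_in (u ++ i :: j :: t) -> path_in (u ++ j :: i :: t).
Proof.
move=> ij tij pw c; have [_ edge_j edge_i] := tile_edges tiled ij tij.
rewrite edges_cat mem_cat add0r /= !inE =>
  /orP[cu|/or3P[/eqP ->|/eqP ->|ct]] //.
  by apply: pw; rewrite edges_cat mem_cat cu.
by apply: pw; rewrite edges_cat mem_cat add0r /= !inE addrAC ct !orbT.
Qed.

Lemma sweep_exists w : full w -> path_in w ->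
  exists2 L, sweep w L & forall v, v \in L -> V v.
Proof.
move: {2}(ordered_pairs _ _) (erefl (ordered_pairs <%O w)) => N.
elim/ltn_ind: N w => N IH w wN fw pw.
have [w_sorted|] := boolP (sorted >=%O w).
  by exists (vertices 0 w); [constructor | move=> v; exact: path_in_vertices].
move=> /(find_tile fw pw)[u [i [j [t [ij wE tij]]]]]; subst w.
have [|||L sL LV] := IH _ _ (u ++ j :: i :: t) erefl.
- by rewrite -wN (ascents_swap _ _ ij).
- exact: full_swap.
- exact: path_in_swap pw.
exists (endpoint u + e i :: L); first exact: sweep_tile.
move=> v; rewrite inE => /orP[/eqP->|/LV //].
by have [] := edge_vertices tiled (path_in_edge pw).
Qed.

Lemma size_sweep w L :
  sweep w L -> size L = (ordered_pairs <%O w + (size w).+1)%N.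
Proof.
elim=> [{}w w_sorted|u i j t {}L ij _ _ IH];
  first by rewrite size_vertices ascents_sorted.
by rewrite /= IH (ascents_swap _ _ ij) !size_cat.
Qed.

Lemma sweep_vertices w L : sweep w L -> forall v, v \in vertices 0 w -> v \in L.
Proof.
elim=> [//|u i j t {}L ij _ _ IH] v.
rewrite mem_vertices_cat add0r /= !inE => /orP[vu|/or3P[vI|-> //|vt]].
- by rewrite IH ?orbT // mem_vertices_cat vu.
- by rewrite IH ?orbT // mem_vertices_cat add0r /= inE vI orbT.
by rewrite IH ?orbT // mem_vertices_cat add0r /= !inE addrAC vt !orbT.
Qed.

Lemma sweep_sweepable (M : multinom n -> Prop) w L :
  sweep w L -> (forall v, v \in L -> M v) -> sweepable M w.
Proof.
elim=> [{}w w_sorted|u i j t {}L ij _ sL IH] LM; first exact: sweepable_sorted.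
have sw : sweepable M (u ++ j :: i :: t).
  by apply: IH => v vL; apply: LM; rewrite inE vL orbT.
apply: sweepable_swap => //; apply: known_swap (sweepable_known sw) _.
by apply: LM; rewrite mem_head.
Qed.

Lemma sorted_word_left_boundary w v : full w -> sorted >=%O w ->
  v \in vertices 0 w -> left_boundary v.
Proof.
move=> fw w_sorted /verticesP[u [t [wE ->]]]; rewrite add0r.
apply/forallP => k; apply/forallP => i; apply/implyP => /andP[ki].
rewrite !endpointE -has_count has_pred1 -(full_count i fw) wE count_cat => ku.
suff /count_memPn -> : i \notin t by rewrite addn0.
apply/negP => it; move: w_sorted;
  rewrite wE (sorted_pairwise ge_trans) pairwise_cat.
by move=> /and3P[/allrelP/(_ k i ku it)]; rewrite /= leEord leqNgt ki.
Qed.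

Lemma sweep_left_vertex w L : full w -> sweep w L -> forall v, v \in L ->
  left_boundary v \/
  exists I i k, [/\ (i < k)%N, F I i k, v = I + e i & I + e k \in L].
Proof.
move=> fw sL; elim: sL fw => [{}w w_sorted|u i j t {}L ij tij sL IH] fw v.
  by move=> vw; left; exact: sorted_word_left_boundary vw.
rewrite inE => /orP[/eqP ->|vL].
  right; exists (endpoint u), i, j; split=> //.
  by rewrite inE (sweep_vertices sL) ?orbT // mem_vertices_cat add0r /=
    !inE eqxx !orbT.
have [|[I [i' [k [ik tik vE lL]]]]] := IH (full_swap fw) v vL; first by left.
by right; exists I, i', k; rewrite inE lL orbT.
Qed.

Lemma full_sorted_word : full (sorted_word (box_top a)).
Proof. exact: endpoint_sorted_word. Qed.

Lemma path_in_sorted_word : path_in (sorted_word (box_top a)).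
Proof.
have fw := full_sorted_word; have := sorted_sorted_word (box_top a).
move: (sorted_word _) fw => w fw w_sorted [J i] /mem_edges[u [t [wE ->]]];
  rewrite add0r.
have w_full k := full_count k fw; rewrite wE in fw w_sorted w_full.
move: w_sorted; rewrite le_sorted_pairwise pairwise_cat /=.
move=> /and3P[/allrelP ui _ /andP[/allP it _]].
apply: (right_boundary_edge tiled) => /= [|||k ik].
- by apply/in_boxP => k; rewrite endpointE -w_full count_cat leq_addr.
- exact: full_letter_lt fw.
- move=> k ki; rewrite endpointE -w_full count_cat /=.
  have /count_memPn -> : k \notin t by
    apply/negP => /it; rewrite leEord leqNgt ki.
  by rewrite -val_eqE /= gtn_eqF ?addn0.
rewrite endpointE; apply/count_memPn/negP => ku.
by have := ui k i ku (mem_head _ _); rewrite leEord leqNgt ik.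
Qed.

Lemma right_boundary_vertex v : in_box a v ->
  (forall i k, (i < k)%N -> (v i < a i)%N -> v k = 0%N) ->
  v \in vertices 0 (sorted_word (box_top a)).
Proof.
move=> v_box boundary.
have -> : sorted_word (box_top a) =
    sorted_word v ++ sorted_word (mnm_sub (box_top a) v).
  apply: le_sorted_eq; first exact: sorted_sorted_word.
    rewrite le_sorted_pairwise pairwise_cat -!le_sorted_pairwise
      !sorted_sorted_word !andbT.
    apply/allrelP => k i;
      rewrite -!has_pred1 !has_count !count_sorted_word !mnmE subn_gt0.
    move=> vk vi; rewrite leEord leqNgt; apply/negP => ik.
    by rewrite (boundary i k) in vk.
  apply: eq_endpoint_perm; rewrite endpoint_cat !endpoint_sorted_word addrC.
  exact/esym/submK.
by apply/verticesP; do 2!eexists; split=> //;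
  rewrite add0r endpoint_sorted_word.
Qed.

Definition index_weight v : nat := (\sum_(i < n) i * v i)%N.

Lemma index_weightDe v i : index_weight (v + e i) = (index_weight v + i)%N.
Proof.
rewrite /index_weight; under eq_bigr do rewrite mnmDE mulnDr.
rewrite big_split /=; congr addn; rewrite (bigD1 i) //= mnm1E eqxx muln1.
by rewrite big1 ?addn0 // => j /negPf ji; rewrite mnm1E eq_sym ji muln0.
Qed.

(* Every vertex off the right boundary is the left vertex of a tile whose
   right vertex is in L by induction; a tile being determined by its right
   vertex, it is the one along which that vertex was swept. *)
Lemma sweep_all_vertices L : sweep (sorted_word (box_top a)) L ->
  forall v, V v -> v \in L.
Proof.
move=> sL v; move: {2}(index_weight v) (erefl (index_weight v)) => N.
elim/ltn_ind: N v => N IH v vN Vv.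
have [/existsP[i /existsP[k /and3P[ik vi vk]]]|nb] := boolP
    [exists i : 'I_n, exists k : 'I_n,
      [&& (i < k)%N, (v i < a i)%N & (0 < v k)%N]]; last first.
  apply: (sweep_vertices sL); apply: right_boundary_vertex;
    first exact: vertex_box tiled _ Vv.
  move=> i k ik vi; apply/eqP; rewrite -leqn0 leqNgt; apply: contra nb => vk.
  by apply/existsP; exists i; apply/existsP; exists k; rewrite ik vi.
have [I [i' [k' [ik' tile vE]]]] := left_vertex_tile tiled Vv ik vi vk.
have [/(edge_vertices tiled)[_ Vr] _ _] := tile_edges tiled ik' tile.
have rL : I + e i' \in L.
  by apply: IH erefl Vr; rewrite -vN vE !index_weightDe ltn_add2l.
have [lb|[I2 [i2 [k2 [ik2 tile2 vE2 lL]]]]] :=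
  sweep_left_vertex full_sorted_word sL rL.
  by have := tile_right_vertex_not_left_boundary ik' tile; rewrite lb.
have [II' _ kk'] := tile_right_vertex_inj tiled ik' ik2 tile tile2 vE2.
by rewrite vE II' kk'.
Qed.

Lemma size_full_sweep_le w L : full w -> sweep w L ->
  (size L <= \sum_(i < n) \sum_(j < n | i < j) a i * a j +
    \sum_(i < n) a i + 1)%N.
Proof.
move=> fw sL; rewrite (size_sweep sL) addn1 -addnS leq_add //.
  apply: leq_trans (ascents_le w) _.
  by apply: leq_sum => i _; apply: leq_sum => j _; rewrite !full_count.
by rewrite -sum_count_size ltnS; apply: leq_sum => i _; rewrite full_count.
Qed.

Lemma tile_complex_vertices_le :
  exists2 L : seq (multinom n), forall v, V v -> v \in L &
  (size L <= \sum_(i < n) \sum_(j < n | i < j) a i * a j +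
    \sum_(i < n) a i + 1)%N.
Proof.
have [L sL _] := sweep_exists full_sorted_word path_in_sorted_word.
exists L; first exact: sweep_all_vertices.
exact: size_full_sweep_le full_sorted_word sL.
Qed.

Lemma tile_complex_determines_box (M : multinom n -> Prop) :
  flip_closed a M -> (forall v, V v -> M v) -> forall I, in_box a I -> M I.
Proof.
move=> M_flip VM.
have [L sL LV] := sweep_exists full_sorted_word path_in_sorted_word.
apply: sweepable_box_known M_flip _;
  apply: sweep_sweepable sL _ => v /LV; exact: VM.
Qed.

End Sweeps.

(** * Planar geometry of tilings *)

Lemma ltn_ord_neq (n : nat) (i k : 'I_n) : (i < k)%N -> i != k.
Proof. by rewrite -val_eqE /= neq_ltn => ->. Qed.

Section PlanarProjection.
Variables (R : realType) (n : nat) (theta : 'I_n -> R).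
Implicit Types (i j k : 'I_n) (x y : 'rV[R]_n) (c t : R).

Lemma planar_proj_is_linear : linear (planar_proj theta).
Proof.
move=> c x y; rewrite /planar_proj scaler_sumr -big_split /=.
by apply: eq_bigr => i _; rewrite !mxE scalerDl scalerA.
Qed.

HB.instance Definition _ :=
  GRing.isLinear.Build R 'rV[R]_n 'rV[R]_2 _ (planar_proj theta)
    planar_proj_is_linear.

Lemma planar_proj_delta i :
  planar_proj theta (delta_mx ord0 i) = dirvec (theta i).
Proof.
rewrite /planar_proj (bigD1 i) //= big1 ?addr0 => [|j /negPf ji].
  by rewrite mxE !eqxx scale1r.
by rewrite mxE eqxx ji scale0r.
Qed.

(* The cross product with the direction of angle t. *)
Lemma planar_proj_cross x t :
  planar_proj theta x ord0 ord0 * sin t -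
  planar_proj theta x ord0 ord_max * cos t =
  \sum_j x ord0 j * sin (t - theta j).
Proof.
rewrite /planar_proj !summxE !mulr_suml -sumrB; apply: eq_bigr => j _.
by rewrite !mxE sinB /=; ring.
Qed.

Lemma horizontal_cross x c t : planar_proj theta x = c *: dirvec 0 ->
  \sum_j x ord0 j * sin (t - theta j) = c * sin t.
Proof. by move=> xc; rewrite -planar_proj_cross xc !mxE /= cos0 sin0; ring. Qed.

Lemma row_addZE x y t i : (x + t *: y) ord0 i = x ord0 i + t * y ord0 i.
Proof. by rewrite !mxE. Qed.

Definition crossing i k : R := sin (theta k - theta i).

Definition hstep i k : 'rV[R]_n :=
  sin (theta k) *: delta_mx ord0 i - sin (theta i) *: delta_mx ord0 k.

Lemma hstep_l i k : i != k -> hstep i k ord0 i = sin (theta k).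
Proof. by move=> /negPf ik; rewrite !mxE !eqxx ik /= mulr1 mulr0 subr0. Qed.

Lemma hstep_r i k : i != k -> hstep i k ord0 k = - sin (theta i).
Proof.
by move=> ik; rewrite !mxE !eqxx eq_sym (negPf ik) /= mulr1 mulr0 sub0r.
Qed.

Lemma hstep_off i k j : j \notin [set i; k]%SET -> hstep i k ord0 j = 0.
Proof.
by rewrite !inE negb_or => /andP[/negPf ji /negPf jk];
  rewrite !mxE ji jk !andbF !mulr0 subr0.
Qed.

Lemma planar_proj_hstep i k :
  planar_proj theta (hstep i k) = crossing i k *: dirvec 0.
Proof.
rewrite /hstep linearB !linearZ /= !planar_proj_delta /crossing sinB.
by apply/rowP=> j; rewrite !mxE; case: eqP => _; rewrite ?cos0 ?sin0; ring.
Qed.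

Lemma planar_proj_hmove i k x t : planar_proj theta (x + t *: hstep i k) =
  planar_proj theta x + (t * crossing i k) *: dirvec 0.
Proof. by rewrite linearD linearZ /= planar_proj_hstep scalerA. Qed.

Hypothesis theta_bound : forall i, 0 < theta i < pi.
Hypothesis theta_incr : forall i j, (i < j)%N -> theta i < theta j.

Lemma sin_theta_gt0 i : 0 < sin (theta i).
Proof. exact: sin_gt0_pi. Qed.

Lemma crossing_gt0 i k : (i < k)%N -> 0 < crossing i k.
Proof.
move=> /theta_incr ik; apply: sin_gt0_pi.
have /andP[ti _] := theta_bound i; have /andP[_ tk] := theta_bound k.
by apply/andP; split; lra.
Qed.

Lemma hstep_unique i k x c : (i < k)%N ->
  (forall j, j \notin [set i; k]%SET -> x ord0 j = 0) ->
  planar_proj theta x = c *: dirvec 0 ->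
  x = (c / crossing i k) *: hstep i k.
Proof.
move=> ik x0 xc; have ik' := ltn_ord_neq ik.
have cross_ik t :
    x ord0 i * sin (t - theta i) + x ord0 k * sin (t - theta k) = c * sin t.
  rewrite -(horizontal_cross t xc) (bigD1 i) //= (bigD1 k) 1?eq_sym //=
    big1 ?addr0 //.
  by move=> j jik; rewrite x0 ?mul0r // !inE negb_or.
have c_neq0 : crossing i k != 0 by rewrite gt_eqF // crossing_gt0.
have := cross_ik (theta k); have := cross_ik (theta i).
rewrite !subrr sin0 !mulr0 add0r addr0 -[theta i - theta k]opprB sinN
  -!/(crossing _ _).
move=> xk xi; apply/rowP => j; rewrite [RHS]mxE.
have [->|ji] := eqVneq j i; first by rewrite hstep_l // mulrAC -xi mulfK.
have [->|jk] := eqVneq j k;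
  first by rewrite hstep_r // mulrAC mulrN -xk mulrN opprK mulfK.
by rewrite hstep_off ?x0 ?mulr0 // !inE negb_or ji.
Qed.

Lemma hstep_gt0 i k j : (i < k)%N -> (0 < hstep i k ord0 j) = (j == i).
Proof.
move=> /ltn_ord_neq ik; have [->|ji] := eqVneq j i;
  first by rewrite hstep_l ?sin_theta_gt0.
have [->|jk] := eqVneq j k;
  first by rewrite hstep_r // oppr_gt0 ltNge ltW ?sin_theta_gt0.
by rewrite hstep_off ?ltxx // !inE negb_or ji.
Qed.

Lemma hstep_lt0 i k j : (i < k)%N -> (hstep i k ord0 j < 0) = (j == k).
Proof.
move=> /ltn_ord_neq ik; have [->|jk] := eqVneq j k;
  first by rewrite hstep_r // oppr_lt0 sin_theta_gt0.
have [->|ji] := eqVneq j i;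
  first by rewrite hstep_l // ltNge ltW ?sin_theta_gt0.
by rewrite hstep_off ?ltxx // !inE negb_or ji.
Qed.

Lemma hstep_scale_inj i k i' k' c c' :
  (i < k)%N -> (i' < k')%N -> 0 < c -> 0 < c' ->
  c *: hstep i k = c' *: hstep i' k' -> i = i' /\ k = k'.
Proof.
move=> ik ik' c_gt0 c'_gt0 /rowP cc'; split; apply/eqP.
  have := cc' i; rewrite mxE [RHS]mxE => cc'i.
  by rewrite -(hstep_gt0 _ ik') -(pmulr_rgt0 _ c'_gt0) -cc'i
    pmulr_rgt0 // hstep_gt0.
have := cc' k; rewrite mxE [RHS]mxE => cc'k.
by rewrite -(hstep_lt0 _ ik') -(pmulr_rlt0 _ c'_gt0) -cc'k
  pmulr_rlt0 // hstep_lt0.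
Qed.

End PlanarProjection.

Section Rays.
Variable R : realType.
Implicit Types (b c d : R).

Lemma near_affine_le b c d :
  c <= b -> (0 < d -> c < b) -> \forall h \near 0^'+, c + h * d <= b.
Proof.
move=> cb dcb; have [d_le0|d_gt0] := lerP d 0; near=> h.
  have h_gt0 : 0 < h by near: h; exact: nbhs_right_gt.
  by apply: le_trans cb; rewrite gerDl pmulr_rle0.
rewrite -lerBrDl -ler_pdivlMr //; near: h; apply: nbhs_right_le.
by rewrite divr_gt0 ?subr_gt0 ?dcb.
Unshelve. all: by end_near. Qed.

Lemma affine_le_limit b c d :
  (forall eps, 0 < eps -> exists2 h, 0 < h < eps & c + h * d <= b) -> c <= b.
Proof.
move=> arbitrarily_small; rewrite leNgt; apply/negP => bc.
have d1_gt0 : 0 < 1 + `|d| by rewrite ltr_pwDl.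
have [|h /andP[h_gt0]] := arbitrarily_small ((c - b) / (1 + `|d|)).
  by rewrite divr_gt0 // subr_gt0.
by rewrite ltr_pdivlMr // => h_lt hb; have := ler_norm (- d);
  rewrite normrN; nra.
Qed.

Lemma affine_ge_limit b c d :
  (forall eps, 0 < eps -> exists2 h, 0 < h < eps & b <= c + h * d) -> b <= c.
Proof.
move=> arbitrarily_small; rewrite -lerN2;
  apply: (affine_le_limit (d := - d)) => eps.
by move/arbitrarily_small => [h h_lt hb]; exists h;
  rewrite // mulrN -opprD lerN2.
Qed.

End Rays.

Section Cells.
Variables (R : realType) (n : nat) (a : 'I_n -> nat) (theta : 'I_n -> R).
Notation vec := 'rV[R]_n.
Implicit Types (i j k : 'I_n) (x y z d : vec) (I : multinom n) (D : {set 'I_n}).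
Implicit Types (J : grid a) (c : cell a).

Lemma cell_setP c x : cell_set c x <->
  forall i, (c.1 i)%:R <= x ord0 i <= (c.1 i)%:R + (i \in c.2)%:R.
Proof.
split=> cx i; have := cx i; case: (boolP (i \in c.2)) => _.
- by case=> /(_ isT).
- by case=> _ -> //; rewrite addr0 lexx.
- by split.
by rewrite addr0 -eq_le eq_sym => /eqP.
Qed.

Lemma cell_set_ray_limit c x d :
  (forall eps, 0 < eps -> exists2 h, 0 < h < eps & cell_set c (x + h *: d)) ->
  cell_set c x.
Proof.
move=> limit; apply/cell_setP => i; apply/andP; split.
  apply: (affine_ge_limit (d := d ord0 i)) => eps
    /limit[h h_lt /cell_setP/(_ i)].
  by rewrite !mxE => /andP[cx _]; exists h.
apply: (affine_le_limit (d := d ord0 i)) => eps /limit[h h_lt /cell_setP/(_ i)].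
by rewrite !mxE => /andP[_ cx]; exists h.
Qed.

Lemma cube_box_ray x d : cube_box a x ->
  (forall j, 0 < d ord0 j -> x ord0 j < (a j)%:R) ->
  (forall j, d ord0 j < 0 -> 0 < x ord0 j) ->
  \forall h \near 0^'+, cube_box a (x + h *: d).
Proof.
move=> x_box x_lt x_gt; apply: filter_forall => j;
  have /andP[x_ge0 x_le] := x_box j.
have le_a := near_affine_le x_le (x_lt j).
have ge_0 : \forall h \near 0^'+, - x ord0 j + h * - d ord0 j <= 0.
  by apply: near_affine_le; rewrite ?oppr_le0 // oppr_gt0 oppr_lt0; exact: x_gt.
near=> h; rewrite !mxE; apply/andP; split; last by near: h.
by rewrite -oppr_le0 opprD -mulrN; near: h.
Unshelve. all: by end_near. Qed.

Definition to_grid I : grid a := [ffun i => inord (I i)].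
Definition of_grid J : multinom n := Multinom [tuple (J i : nat) | i < n].

Lemma of_gridE J i : of_grid J i = J i. Proof. exact: mnmE. Qed.

Lemma to_gridE I i : in_box a I -> to_grid I i = I i :> nat.
Proof. by move=> /in_boxP I_box; rewrite ffunE inordK // ltnS. Qed.

Lemma of_grid_box J : in_box a (of_grid J).
Proof. by apply/in_boxP => i; rewrite of_gridE -ltnS ltn_ord. Qed.

Lemma of_gridK : cancel of_grid to_grid.
Proof.
by move=> J; apply/ffunP=> i; apply: ord_inj;
  rewrite to_gridE ?of_gridE // of_grid_box.
Qed.

Lemma to_gridK I : in_box a I -> of_grid (to_grid I) = I.
Proof. by move=> I_box; apply/mnmP => i; rewrite of_gridE to_gridE. Qed.

Definition indicator D : multinom n := \sum_(i in D) e i.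

Lemma indicatorE D j : indicator D j = (j \in D).
Proof.
rewrite mnm_sumE; case: (boolP (j \in D)) => jD.
  by rewrite (bigD1 j) //= mnm1E eqxx big1 // => i /andP[_ /negPf ij];
    rewrite mnm1E ij.
by rewrite big1 // => i iD; rewrite mnm1E; case: eqP jD => [<-|//]; rewrite iD.
Qed.

Lemma indicator0 : indicator finset.set0 = 0.
Proof. exact: finset.big_set0. Qed.

Lemma indicator1 i : indicator [set i]%SET = e i. Proof. exact: big_set1. Qed.

Lemma indicator2 i k : i != k -> indicator [set i; k]%SET = e i + e k.
Proof. by move=> ik; rewrite /indicator big_setU1 ?big_set1 // inE. Qed.

Lemma indicator3 i j k : i != j -> j != k -> i != k ->
  indicator [set i; j; k]%SET = e i + e j + e k.
Proof.
move=> ij jk ik; have k_notin : k \notin [set i; j]%SET.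
  by rewrite !inE negb_or ![k == _]eq_sym ik jk.
by rewrite finset.setUC /indicator big_setU1 //= -/(indicator _)
  indicator2 // [RHS]addrC.
Qed.

Definition half_point I D : vec := \row_j ((I j)%:R + (j \in D)%:R / 2).

Lemma half_between_nat (p q : nat) (b b' : bool) :
  (p%:R <= (q%:R + b%:R / 2 : R) <= p%:R + b'%:R) =
  (p <= q)%N && (q + b <= p + b')%N.
Proof.
have double (r s : nat) :
    ((r%:R : R) <= s%:R) = ((2 * r)%:R <= (2 * s)%:R :> R).
  by rewrite !ler_nat leq_pmul2l.
have -> : ((p%:R : R) <= q%:R + b%:R / 2) = (2 * p <= 2 * q + b)%N.
  by rewrite -(ler_nat R) natrD !natrM; apply/idP/idP; lra.
have -> :
    ((q%:R + b%:R / 2 : R) <= p%:R + b'%:R) = (2 * q + b <= 2 * (p + b'))%N.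
  by rewrite -(ler_nat R) natrD !natrM natrD; apply/idP/idP; lra.
by case: b b' => -[]; apply/idP/idP; lia.
Qed.

Lemma cell_half_pointP c I D : cell_set c (half_point I D) <->
  forall j, (c.1 j <= I j)%N && (I j + (j \in D) <= c.1 j + (j \in c.2))%N.
Proof.
by rewrite cell_setP; split=> cI j; have := cI j; rewrite mxE half_between_nat.
Qed.

Lemma cell_set_half_point I D :
  in_box a I -> cell_set (to_grid I, D) (half_point I D).
Proof.
by move=> I_box; apply/cell_half_pointP => j; rewrite to_gridE // !leqnn.
Qed.

End Cells.

Section TilingGeometry.
Variables (R : realType) (n : nat) (a : 'I_n -> nat) (theta : 'I_n -> R).
Hypothesis theta_bound : forall i, 0 < theta i < pi.
Hypothesis theta_incr : forall i j : 'I_n, (i < j)%N -> theta i < theta j.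
Notation vec := 'rV[R]_n.
Notation proj := (planar_proj theta).
Implicit Types (i j k p q : 'I_n) (x y z : vec) (I : multinom n)
  (D : {set 'I_n}).
Implicit Types (J : grid a) (c : cell a).

Variable T : {set cell a}.

Definition lattice_cell I D : Prop :=
  in_box a (I + indicator D) /\ (to_grid a I, D) \in T.

Definition tiling_vertex I : Prop := lattice_cell I finset.set0.
Definition tiling_edge I i : Prop := lattice_cell I [set i]%SET.
Definition tiling_tile I i k : Prop := lattice_cell I [set i; k]%SET.

Hypothesis T_subcomplex : subcomplex T.

Lemma lattice_cell_box I D : lattice_cell I D -> in_box a I.
Proof. by case=> /in_boxDl. Qed.

Lemma subcomplex_lattice_cell c I D : c \in T ->
  (forall j, (c.1 j <= I j)%N && (I j + (j \in D) <= c.1 j + (j \in c.2))%N) ->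
  lattice_cell I D.
Proof.
have [T_fits T_faces] := T_subcomplex.
move=> cT bounds; have /forall_inP fits_c := T_fits _ cT.
have ID_box : in_box a (I + indicator D).
  apply/in_boxP => j; rewrite mnmDE indicatorE.
  have /andP[_ /leq_trans] := bounds j; apply.
  case: (boolP (j \in c.2)) => [/fits_c|_]; first by rewrite addn1.
  by rewrite addn0 -ltnS ltn_ord.
split=> //; apply: (T_faces c) => //; apply/andP; split=> /=.
  by apply/fintype.subsetP => j jD; have := bounds j; rewrite jD;
    case: (j \in c.2) => //; lia.
apply/existsP; exists [set j in c.2 :\: D | (c.1 j < I j)%N]%SET;
  apply/andP; split.
  by apply/fintype.subsetP => j; rewrite inE => /andP[].
apply/eqP/ffunP => j; apply: ord_inj;
  rewrite to_gridE ?(in_boxDl ID_box) // !ffunE !inE.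
have I_le : (I j <= a j)%N by apply/in_boxP: j; exact: in_boxDl ID_box.
by have := bounds j; case: (j \in c.2) (j \in D) => -[] /=;
  case: ltnP => /= ? ?; rewrite inordK; lia.
Qed.

Lemma lattice_cell_face I D I' D' : lattice_cell I D ->
  (forall j, (I j <= I' j)%N && (I' j + (j \in D') <= I j + (j \in D))%N) ->
  lattice_cell I' D'.
Proof.
move=> [ID_box cT] faces; apply: subcomplex_lattice_cell cT _ => j.
by rewrite to_gridE ?(in_boxDl ID_box).
Qed.

Lemma grid_lattice_cell J D : (J, D) \in T -> lattice_cell (of_grid J) D.
Proof.
by move=> cT; apply: subcomplex_lattice_cell cT _ => j; rewrite of_gridE !leqnn.
Qed.

Lemma tile_edges_in_tiling I i k : (i < k)%N -> tiling_tile I i k ->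
  [/\ tiling_edge I i, tiling_edge I k & tiling_edge (I + e k) i].
Proof.
move=> /ltn_ord_neq/negPf ik tile.
by split; apply: lattice_cell_face tile _ => j;
  rewrite ?mnmDE ?mnm1E !inE ?[k == j]eq_sym;
  have [->|_] := eqVneq j i; rewrite ?ik /=; try case: (j == k); lia.
Qed.

Lemma edge_vertices_in_tiling I i :
  tiling_edge I i -> tiling_vertex I /\ tiling_vertex (I + e i).
Proof.
by move=> edge; split; apply: lattice_cell_face edge _ => j;
  rewrite ?mnmDE ?mnm1E !inE ?[i == j]eq_sym; case: (j == i); lia.
Qed.

Lemma tile_in_box I i k : (i < k)%N -> tiling_tile I i k ->
  in_box a (I + e i + e k).
Proof. by move=> /ltn_ord_neq ik [+ _]; rewrite indicator2 // addrA. Qed.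

Lemma cell_in_cube_box c x : c \in T -> cell_set c x -> cube_box a x.
Proof.
have [T_fits _] := T_subcomplex.
move=> /T_fits/forall_inP fits_c /cell_setP cx i; have /andP[lo hi] := cx i.
rewrite (le_trans _ lo) ?ler0n //=; apply: le_trans hi _;
  rewrite -natrD ler_nat.
case: (boolP (i \in c.2)) => [/fits_c|_]; first by rewrite addn1.
by rewrite addn0 -ltnS ltn_ord.
Qed.

Hypothesis T_dim : complex_dim T = 2%N.
Hypothesis T_bij : set_bij (realization (R := R) T) (shadow a theta) proj.

Lemma tiling_proj_inj x y c c' : c \in T -> cell_set c x -> c' \in T ->
  cell_set c' y -> proj x = proj y -> x = y.
Proof.
have [_ inj _] := T_bij; move=> cT cx c'T c'y xy.
by apply: inj => //; rewrite inE; [exists c|exists c'].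
Qed.

Lemma tiling_covers (u : 'rV[R]_2) : shadow a theta u ->
  exists c z, [/\ c \in T, cell_set c z & proj z = u].
Proof. by have [_ _ surj] := T_bij => /surj[z [c cT cz] zu]; exists c, z. Qed.

Lemma cell_along_ray (u : R -> 'rV[R]_2) :
  (\forall h \near 0^'+, shadow a theta (u h)) ->
  exists2 c, c \in T & forall eps, 0 < eps ->
    exists h z, [/\ 0 < h < eps, cell_set c z & proj z = u h].
Proof.
move=> u_shadow; apply: contrapT => no_cell.
have avoid c :
    \forall h \near 0^'+, ~ (c \in T /\ exists2 z, cell_set c z & proj z = u h).
  have [cT|_] := boolP (c \in T); last by near=> h => -[].
  have [eps eps_gt0 eps_avoid] : exists2 eps : R, 0 < eps &
      forall h z, 0 < h < eps -> cell_set c z -> proj z <> u h.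
    apply: contrapT => no_eps; apply: no_cell; exists c => // eps eps_gt0.
    apply: contrapT => no_h; apply: no_eps; exists eps => // h z h_eps cz zu.
    by apply: no_h; exists h, z.
  near=> h => -[_ [z cz zu]]; apply: (eps_avoid h z) => //; apply/andP; split.
    by near: h; exact: nbhs_right_gt.
  by near: h; exact: nbhs_right_lt.
have both : \forall h \near 0^'+, shadow a theta (u h) /\
    forall c, ~ (c \in T /\ exists2 z, cell_set c z & proj z = u h).
  by near=> h; split; near: h => //; exact: filter_forall.
have [h [/tiling_covers[c [z [cT cz zu]]] avoid_h]] :=
  filter_ex (FF := at_right_proper_filter 0) both.
by apply: (avoid_h c); split=> //; exists z.
Unshelve. all: by end_near. Qed.

Lemma horizontal_chord_two_dim c y z (r : R) :
  c \in T -> cell_set c y -> cell_set c z ->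
  proj (y - z) = r *: dirvec 0 -> r != 0 ->
  exists i k, (i < k)%N /\ c.2 = [set i; k]%SET.
Proof.
move=> cT /cell_setP cy /cell_setP cz yz r_neq0.
have cross0 t : 0 < sin t -> (forall j, j \in c.2 -> theta j = t) -> False.
  move=> sin_gt0 c2_t; have := horizontal_cross t yz;
    rewrite big1 => [/esym/eqP|j _].
    by rewrite mulf_eq0 (negPf r_neq0) gt_eqF.
  have [/c2_t ->|jc] := boolP (j \in c.2); first by rewrite subrr sin0 mulr0.
  have := cy j; have := cz j;
    rewrite (negPf jc) addr0 -!eq_le !mxE => /eqP <- /eqP <-.
  by rewrite subrr mul0r.
have : (#|c.2| <= 2)%N by rewrite -T_dim /complex_dim (bigD1 c) //= leq_maxl.
case card_c2: #|c.2| => [|[|[|//]]] _.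
- move/eqP: card_c2; rewrite cards_eq0 => /eqP c2_0.
  have pi2_gt0 : 0 < sin (pi / 2 : R) by rewrite sin_pihalf.
  by case: (cross0 _ pi2_gt0) => j; rewrite c2_0 inE.
- move/eqP/cards1P: card_c2 => [i c2_i].
  case: (cross0 _ (sin_theta_gt0 theta_bound i)) => j.
  by rewrite c2_i inE => /eqP ->.
move/eqP/cards2P: card_c2 => [i [k [ik ->]]].
have [lt|gt] := ltnP i k; first by exists i, k.
by exists k, i; rewrite finset.setUC ltn_neqAle eq_sym val_eqE ik.
Qed.

(* Over the horizontal ray from proj x some cell of T has points arbitrarily
   close to proj x; being closed and two-dimensional, it contains x and a
   segment leaving x in a direction hstep i k. *)
Lemma horizontal_tile x c s : s != 0 -> c \in T -> cell_set c x ->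
  (\forall h \near 0^'+, shadow a theta (proj x + (s * h) *: dirvec 0)) ->
  exists J i k t, [/\ (i < k)%N, 0 < t, (J, [set i; k]%SET) \in T,
    cell_set (J, [set i; k]%SET) x &
    cell_set (J, [set i; k]%SET) (x + (s * t) *: hstep theta i k)].
Proof.
move=> s0 cT cx /cell_along_ray[[J D] JDT ray].
have [h1 [z1 [/andP[h1_gt0 _] cz1 pz1]]] := ray 1 ltr01.
have [h2 [z2 [/andP[h2_gt0 h21] cz2 pz2]]] := ray h1 h1_gt0.
have proj_diff z h : proj z = proj x + (s * h) *: dirvec 0 ->
    proj (z - z1) = (s * (h - h1)) *: dirvec 0.
  by move=> pz;
    rewrite linearB /= pz pz1 opprD addrACA subrr add0r -scalerBl mulrBr.
have [|i [k [ik /= DE]]] :=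
  horizontal_chord_two_dim JDT cz2 cz1 (proj_diff _ _ pz2).
  by rewrite mulf_neq0 // subr_eq0 lt_eqF.
subst D; have t_gt0 : 0 < h1 / crossing theta i k.
  by rewrite divr_gt0 ?crossing_gt0.
have on_ray h z : cell_set (J, [set i; k]%SET) z ->
    proj z = proj x + (s * h) *: dirvec 0 ->
      z = z1 + ((s * (h - h1)) / crossing theta i k) *: hstep theta i k.
  move=> /cell_setP cz pz; apply/eqP; rewrite addrC -subr_eq; apply/eqP.
  apply: (hstep_unique theta_bound theta_incr ik _ (proj_diff _ _ pz)) => j jik.
  move/cell_setP/(_ j): cz1; have := cz j.
  by rewrite (negPf jik) addr0 -!eq_le !mxE => /eqP <- /eqP <-; rewrite subrr.
pose x' := z1 + - (s * h1 / crossing theta i k) *: hstep theta i k.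
have cx' : cell_set (J, [set i; k]%SET) x'.
  apply: (cell_set_ray_limit (d := (s / crossing theta i k) *: hstep theta i k))
    => eps.
  move=> /ray[h [z [h_eps cz pz]]]; exists h; rewrite // (_ : _ + _ = z) //.
  rewrite (on_ray h z cz pz) /x' -addrA scalerA -scalerDl; congr (_ + _ *: _).
  by ring.
have x'E : x' = x.
  apply: (tiling_proj_inj JDT cx' cT cx);
    rewrite planar_proj_hmove pz1 mulNr scaleNr.
  by rewrite divfK ?addrK // gt_eqF // crossing_gt0.
exists J, i, k, (h1 / crossing theta i k); split=> //; first by rewrite -x'E.
by rewrite -x'E /x' scaleNr mulrA subrK.
Qed.

Lemma horizontal_shadow x i k s : (i < k)%N -> cube_box a x -> s != 0 ->
  (forall j, 0 < s * hstep theta i k ord0 j -> x ord0 j < (a j)%:R) ->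
  (forall j, s * hstep theta i k ord0 j < 0 -> 0 < x ord0 j) ->
  \forall h \near 0^'+, shadow a theta (proj x + (s * h) *: dirvec 0).
Proof.
move=> ik x_box s0 x_lt x_gt.
have c_gt0 := crossing_gt0 theta_bound theta_incr ik.
have : \forall h \near 0^'+,
    cube_box a (x + h *: ((s / crossing theta i k) *: hstep theta i k)).
  apply: cube_box_ray => // j; rewrite mxE mulrAC.
    by rewrite pmulr_lgt0 ?invr_gt0 //; exact: x_lt.
  by rewrite pmulr_llt0 ?invr_gt0 //; exact: x_gt.
apply: filterS => h h_box;
  exists (x + h *: ((s / crossing theta i k) *: hstep theta i k)) => //.
rewrite scalerA planar_proj_hmove; congr (_ + _ *: _).
by field; rewrite gt_eqF.
Qed.

Lemma right_shadow x i k : (i < k)%N -> cube_box a x ->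
  x ord0 i < (a i)%:R -> 0 < x ord0 k ->
  \forall h \near 0^'+, shadow a theta (proj x + (1 * h) *: dirvec 0).
Proof.
move=> ik x_box xi xk; apply: (horizontal_shadow ik) => // j; rewrite mul1r.
  by rewrite hstep_gt0 // => /eqP ->.
by rewrite hstep_lt0 // => /eqP ->.
Qed.

Lemma left_shadow x i k : (i < k)%N -> cube_box a x ->
  0 < x ord0 i -> x ord0 k < (a k)%:R ->
  \forall h \near 0^'+, shadow a theta (proj x + (-1 * h) *: dirvec 0).
Proof.
move=> ik x_box xi xk; apply: (horizontal_shadow ik) => // j; rewrite mulN1r.
  by rewrite oppr_gt0 hstep_lt0 // => /eqP ->.
by rewrite oppr_lt0 hstep_gt0 // => /eqP ->.
Qed.

Lemma right_step_bounds J i k x t : (i < k)%N -> 0 < t ->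
  cell_set (J, [set i; k]%SET) (x + t *: hstep theta i k) ->
  x ord0 i < (J i)%:R + 1 /\ (J k)%:R < x ord0 k.
Proof.
move=> ik t_gt0 /cell_setP cx; have ik' := ltn_ord_neq ik; split.
  have /andP[_] := cx i; rewrite !inE eqxx /= row_addZE hstep_l //.
  by apply: lt_le_trans; rewrite ltrDl mulr_gt0 ?sin_theta_gt0.
have /andP[+ _] := cx k;
  rewrite row_addZE hstep_r // mulrN => /le_lt_trans; apply.
by rewrite ltrBlDr ltrDl mulr_gt0 ?sin_theta_gt0.
Qed.

Lemma left_step_bounds J i k x t : (i < k)%N -> t < 0 ->
  cell_set (J, [set i; k]%SET) (x + t *: hstep theta i k) ->
  (J i)%:R < x ord0 i /\ x ord0 k < (J k)%:R + 1.
Proof.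
move=> ik t_lt0 /cell_setP cx; have ik' := ltn_ord_neq ik; split.
  have /andP[+ _] := cx i; rewrite row_addZE hstep_l // => /le_lt_trans; apply.
  by rewrite gtrDl nmulr_rlt0 ?sin_theta_gt0.
have /andP[_] := cx k; rewrite !inE eqxx orbT /= row_addZE hstep_r //.
by apply: lt_le_trans; rewrite ltrDl nmulr_rgt0 ?oppr_lt0 ?sin_theta_gt0.
Qed.

Lemma half_pointE I D j : half_point R I D ord0 j = (I j)%:R + (j \in D)%:R / 2.
Proof. exact: mxE. Qed.

Lemma half_point_box I D : lattice_cell I D -> cube_box a (half_point R I D).
Proof.
move=> ID; apply: (cell_in_cube_box ID.2);
  exact: cell_set_half_point (lattice_cell_box ID).
Qed.

Lemma horizontal_tile_half_point I D s : lattice_cell I D -> s != 0 ->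
  (\forall h \near 0^'+,
    shadow a theta (proj (half_point R I D) + (s * h) *: dirvec 0)) ->
  exists J i k t, [/\ (i < k)%N, 0 < t, (J, [set i; k]%SET) \in T,
    forall j, (J j <= I j)%N &&
      (I j + (j \in D) <= J j + (j \in [set i; k]%SET))%N &
    cell_set (J, [set i; k]%SET)
      (half_point R I D + (s * t) *: hstep theta i k)].
Proof.
move=> ID s0 shadow_near.
have cID := cell_set_half_point R D (lattice_cell_box ID).
have [J [i [k [t [ik t_gt0 tile /cell_half_pointP bounds ct]]]]] :=
  horizontal_tile s0 ID.2 cID shadow_near.
by exists J, i, k, t.
Qed.

Lemma left_vertex_tile_in_tiling v i k :
  tiling_vertex v -> (i < k)%N -> (v i < a i)%N -> (0 < v k)%N ->
  exists I i' k', [/\ (i' < k')%N, tiling_tile I i' k' & v = I + e k'].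
Proof.
move=> vertex ik vi vk.
have vE j : half_point R v finset.set0 ord0 j = (v j)%:R.
  by rewrite half_pointE inE mul0r addr0.
have shadow_right := right_shadow ik (half_point_box vertex).
rewrite !vE ltr_nat ltr0n in shadow_right.
have [J [p [q [t [pq t_gt0 tile bounds]]]]] :=
  horizontal_tile_half_point vertex (oner_neq0 R) (shadow_right vi vk).
rewrite mul1r => /(right_step_bounds pq t_gt0);
  rewrite !vE natr1 !ltr_nat => -[vp vq].
exists (of_grid J), p, q; split=> //; first exact: grid_lattice_cell.
apply/mnmP => j; rewrite mnmDE mnm1E of_gridE; have := bounds j;
  rewrite !inE addn0.
have [->|jp] := eqVneq j p;
  first by rewrite [q == p]eq_sym (negPf (ltn_ord_neq pq)) /=; lia.
by have [->|jq] := eqVneq j q;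
  rewrite /= ?eqxx ?[q == j]eq_sym ?(negPf jq); lia.
Qed.

Lemma edge_left_tile_in_tiling I i k : tiling_edge I i ->
  ((i < k)%N && (I k < a k)%N) || ((k < i)%N && (0 < I k)%N) ->
  (exists2 k' : 'I_n, (i < k')%N & tiling_tile I i k') \/
  (exists I' k', [/\ (k' < i)%N, I = I' + e k' & tiling_tile I' k' i]).
Proof.
move=> edge side.
have IE j : j != i -> half_point R I [set i]%SET ord0 j = (I j)%:R.
  by move=> /negPf ji; rewrite half_pointE inE ji mul0r addr0.
have IiE : half_point R I [set i]%SET ord0 i = (I i)%:R + 2^-1.
  by rewrite half_pointE inE eqxx mul1r.
have x_box := half_point_box edge.
have Ii_lt : (I i < a i)%N.
  by have /in_boxP/(_ i) := edge.1; rewrite mnmDE indicatorE inE eqxx addn1.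
have shadow_left : \forall h \near 0^'+,
    shadow a theta (proj (half_point R I [set i]%SET) + (-1 * h) *: dirvec 0).
  have Ii_le : (I i)%:R + 1 <= (a i)%:R :> R by rewrite natr1 ler_nat.
  have Ii_ge0 : 0 <= (I i)%:R :> R by exact: ler0n.
  case/orP: side => /andP[lt Ik].
    apply: (left_shadow lt x_box); first by rewrite IiE; lra.
    by rewrite IE ?ltr_nat // eq_sym ltn_ord_neq.
  apply: (left_shadow lt x_box); last by rewrite IiE; lra.
  by rewrite IE ?ltr0n // ltn_ord_neq.
have [|J [p [q [t [pq t_gt0 tile bounds]]]]] :=
  horizontal_tile_half_point edge _ shadow_left.
  by rewrite oppr_eq0 oner_eq0.
rewrite mulN1r => /(left_step_bounds pq);
  rewrite oppr_lt0 => /(_ t_gt0)[p_gt q_lt].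
have pq' := ltn_ord_neq pq.
have : i \in [set p; q]%SET.
  by have := bounds i; rewrite !inE eqxx; case: (_ || _) => //; lia.
rewrite !inE => /orP[]/eqP iE; subst i.
  left; exists q => //; suff -> : I = of_grid J by exact: grid_lattice_cell.
  rewrite (IE q) 1?eq_sym // natr1 ltr_nat in q_lt.
  apply/mnmP => j; rewrite of_gridE; have := bounds j; rewrite !inE.
  have [->|jp] := eqVneq j p; first by rewrite /=; lia.
  by have [->|jq] := eqVneq j q; rewrite /=; lia.
right; exists (of_grid J), p; split=> //; last exact: grid_lattice_cell.
rewrite (IE p) // ltr_nat in p_gt.
apply/mnmP => j; rewrite mnmDE mnm1E of_gridE; have := bounds j;
  rewrite !inE [p == j]eq_sym.
have [->|jp] := eqVneq j p; first by rewrite (negPf pq') /=; lia.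
by have [->|jq] := eqVneq j q; rewrite /=; lia.
Qed.

Lemma tile_left_of_right_vertex I i k t : (i < k)%N -> tiling_tile I i k ->
  0 <= t <= 1 ->
  cell_set (to_grid a I, [set i; k]%SET)
    (half_point R (I + e i) finset.set0 + - t *: hstep theta i k).
Proof.
move=> ik tile /andP[t_ge0 t_le1]; have ik' := ltn_ord_neq ik.
apply/cell_setP => j; rewrite to_gridE ?(lattice_cell_box tile) // row_addZE.
rewrite half_pointE inE mul0r addr0 mnmDE mnm1E natrD !inE.
have ratio u : 0 <= t * sin (theta u) <= 1.
  by rewrite mulr_ge0 ?mulr_ile1 ?sin_le1 // ltW ?sin_theta_gt0.
have [->|ji] := eqVneq j i.
  by rewrite hstep_l //= mulNr; have /andP[] := ratio k; move: (t * _) => r *;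
    apply/andP; split; lra.
have [->|jk] := eqVneq j k.
  by rewrite hstep_r //= mulrNN; have /andP[] := ratio i; move: (t * _) => r *;
    apply/andP; split; lra.
by rewrite hstep_off ?mulr0 ?addr0 ?lexx // !inE negb_or ji.
Qed.

Lemma tile_right_vertex_inj_in_tiling I I' i k i' k' :
  (i < k)%N -> (i' < k')%N ->
  tiling_tile I i k -> tiling_tile I' i' k' -> I + e i = I' + e i' ->
  [/\ I = I', i = i' & k = k'].
Proof.
move=> ik ik' tile tile' vE.
have crossing_unit p q : (p < q)%N -> 0 <= crossing theta p q <= 1.
  by move=> pq; rewrite ltW ?crossing_gt0 //= sin_le1.
have chord := tile_left_of_right_vertex ik tile (crossing_unit _ _ ik').
have chord' := tile_left_of_right_vertex ik' tile' (crossing_unit _ _ ik).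
have := tiling_proj_inj tile.2 chord tile'.2 chord'.
rewrite vE !planar_proj_hmove !mulNr [_ * crossing _ i k]mulrC !scaleNr.
move=> /(_ erefl)/addrI/oppr_inj/(hstep_scale_inj theta_bound ik ik').
case; rewrite ?crossing_gt0 // => ii kk; subst i' k'; split=> //.
by apply/mnmP => j; have /mnmP/(_ j) := vE; rewrite !mnmDE => /addIn.
Qed.

Lemma right_boundary_preimage x z i : cube_box a z ->
  (forall k, (k < i)%N -> x ord0 k = (a k)%:R) ->
  (forall k, (i < k)%N -> x ord0 k = 0) ->
  proj z = proj x -> z = x.
Proof.
move=> z_box x_lo x_hi zx.
have sin_lt k : (k < i)%N -> 0 < sin (theta i - theta k) by exact: crossing_gt0.
have sin_gt k : (i < k)%N -> sin (theta i - theta k) < 0.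
  by move=> ik; rewrite -opprB sinN oppr_lt0; exact: crossing_gt0.
pose term j := (x - z) ord0 j * sin (theta i - theta j).
have term_ge0 j : 0 <= term j.
  have /andP[zj_ge0 zj_le] := z_box j; rewrite /term 2!mxE.
  case: (ltngtP j i) => [ji|ij|/val_inj ->]; last by rewrite subrr sin0 mulr0.
    by rewrite mulr_ge0 ?(ltW (sin_lt _ ji)) // x_lo // subr_ge0.
  by rewrite mulr_le0 ?(ltW (sin_gt _ ij)) // x_hi // add0r oppr_le0.
have sum0 : \sum_j term j = 0.
  by rewrite (horizontal_cross (c := 0)) ?mul0r // linearB /= zx subrr scale0r.
have xz_off j : j != i -> (x - z) ord0 j = 0.
  move=> ji; have /eqP : term j = 0.
    by apply: (psumr_eq0P _ sum0) => // j' _; exact: term_ge0.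
  rewrite mulf_eq0 => /orP[/eqP //|]; move: ji;
    rewrite -val_eqE neq_ltn /= => /orP[/sin_lt|/sin_gt].
    by move=> /gt_eqF ->.
  by move=> /lt_eqF ->.
have [r xz] : exists r, x - z = r *: delta_mx ord0 i.
  exists ((x - z) ord0 i); apply/rowP => j;
    rewrite [RHS]mxE [delta_mx _ _ _ _]mxE eqxx.
  by have [->|ji] := eqVneq j i; rewrite ?mulr1 // mulr0 xz_off.
have /rowP/(_ ord_max)/eqP : proj (x - z) = 0 by rewrite linearB /= zx subrr.
rewrite xz linearZ /= planar_proj_delta !mxE /= mulf_eq0.
rewrite (gt_eqF (sin_theta_gt0 theta_bound i)) orbF.
by move=> /eqP r0; apply/esym/eqP; rewrite -subr_eq0 xz r0 scale0r.
Qed.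

Lemma right_boundary_edge_in_tiling I i : in_box a I -> (I i < a i)%N ->
  (forall k, (k < i)%N -> I k = a k) -> (forall k, (i < k)%N -> I k = 0%N) ->
  tiling_edge I i.
Proof.
move=> I_box Ii I_lo I_hi; pose x := half_point R I [set i]%SET.
have x_box : cube_box a x.
  move=> j; rewrite half_pointE inE; have /in_boxP/(_ j) := I_box;
    rewrite -(ler_nat R).
  have : 0 <= (I j)%:R :> R by exact: ler0n.
  have [->|_] := eqVneq j i; last by rewrite mul0r addr0 => -> ->.
  have : (I i)%:R + 1 <= (a i)%:R :> R by rewrite natr1 ler_nat.
  by rewrite mul1r => *; apply/andP; split; lra.
have [|c [z [cT cz zx]]] := tiling_covers (u := proj x); first by exists x.
suff xz : z = x.
  by move: cz; rewrite xz => /cell_half_pointP; exact: subcomplex_lattice_cell.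
apply: (right_boundary_preimage (i := i) (cell_in_cube_box cT cz) _ _ zx)
  => k ki.
  by rewrite half_pointE inE -val_eqE ltn_eqF // mul0r addr0 I_lo.
by rewrite half_pointE inE -val_eqE gtn_eqF // mul0r addr0 I_hi.
Qed.

End TilingGeometry.

Lemma tiling_tile_complex (R : realType) (n : nat) (a : 'I_n -> nat)
    (theta : 'I_n -> R) (T : {set cell a}) :
  (0 < n)%N -> (forall i, (0 < a i)%N) -> (forall i, 0 < theta i < pi) ->
  (forall i j : 'I_n, (i < j)%N -> theta i < theta j) -> tiling theta T ->
  tile_complex a (tiling_vertex T) (tiling_edge T) (tiling_tile T).
Proof.
move=> n_gt0 a_gt0 theta_bound theta_incr [T_sub T_dim [T_bij _ _]].
have boundary :=
  right_boundary_edge_in_tiling theta_bound theta_incr T_sub T_bij.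
have origin_edge : tiling_edge T 0 (Ordinal n_gt0).
  by apply: boundary => [||k|k]; rewrite ?mnm0E //; apply/in_boxP => k;
    rewrite mnm0E.
split=> //.
- by have [] := edge_vertices_in_tiling T_sub origin_edge.
- by move=> I; exact: lattice_cell_box.
- by move=> I i k; exact: tile_in_box.
- by move=> I i; exact: edge_vertices_in_tiling.
- by move=> I i k; exact: tile_edges_in_tiling.
- by move=> I i k; exact: edge_left_tile_in_tiling.
- by move=> I I' i k i' k'; exact: tile_right_vertex_inj_in_tiling.
by move=> v i k; exact: left_vertex_tile_in_tiling.
Qed.

(** * The coordinate ring *)

Section SmallSupport.
Variables (n : nat) (a : 'I_n -> nat).
Implicit Types (J : grid a) (D : {set 'I_n}).

Definition grid_supp J : {set 'I_n} := [set i | (0 < J i)%N]%SET.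

Definition small_support J : bool := (#|grid_supp J| <= 2)%N.

Lemma size_supp_seq_of_grid J : size (supp_seq (of_grid J)) = #|grid_supp J|.
Proof.
rewrite cardE /supp_seq enumT /enum_mem; congr size; apply: eq_filter => i.
by rewrite of_gridE -[RHS]/(i \in grid_supp J) inE.
Qed.

Lemma card_grid_supp D :
  #|[pred J : grid a | grid_supp J == D]| = (\prod_(i in D) a i)%N.
Proof.
pose F i : pred 'I_(a i).+1 := fun x => (0 < x)%N == (i \in D).
have -> : #|[pred J : grid a | grid_supp J == D]| =
    #|(family F : simpl_pred (grid a))|.
  apply: eq_card => J; rewrite !inE; apply/eqP/familyP => [DE i|JF].
    by rewrite /= /in_mem /= /F -DE inE.
  by apply/setP => i; rewrite inE; have := JF i;
    rewrite /= /in_mem /= /F => /eqP.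
rewrite card_family foldrE big_map big_enum /= [RHS]big_mkcond /=.
apply: eq_bigr => i _; rewrite /F; case: (i \in D).
  rewrite -[RHS]/((a i).+1.-1) -[(a i).+1 in RHS]card_ord
    -(cardC1 (@ord0 (a i))).
  by apply: eq_card => x; rewrite !inE /in_mem /= eqb_id lt0n.
rewrite -[RHS](card1 (@ord0 (a i))); apply: eq_card => x.
by rewrite -[LHS]/((0 < x)%N == false) -[RHS]/(x == ord0) -val_eqE /=;
  case: (nat_of_ord x).
Qed.

Lemma sum_sets_le2 (G : {set 'I_n} -> nat) :
  (\sum_(D : {set 'I_n} | (#|D| <= 2)%N) G D =
   \sum_(i < n) \sum_(j < n | i < j) G [set i; j]%SET +
   \sum_(i < n) G [set i]%SET +
   G finset.set0)%N.
Proof.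
rewrite (bigID (fun D : {set 'I_n} => #|D| == 2)) /=.
rewrite [X in (_ + X = _)%N](bigID (fun D : {set 'I_n} => #|D| == 1)) /= addnA.
congr (_ + _ + _)%N.
- rewrite pair_big_dep /=
  -(big_imset (h := fun p : 'I_n * 'I_n => [set p.1; p.2]%SET) G
    (A := [pred p : 'I_n * 'I_n | (p.1 < p.2)%N])) /=; last first.
    move=> [i j] [k l] /=; rewrite !inE /= => ij kl /setP ijkl.
    have : i \in [set k; l]%SET by rewrite -ijkl !inE eqxx.
    have : j \in [set k; l]%SET by rewrite -ijkl !inE eqxx orbT.
    have : k \in [set i; j]%SET by rewrite ijkl !inE eqxx.
    by rewrite !inE; do 3![case/orP=> /eqP ?]; subst => //; lia.
  apply: eq_bigl => D;
    apply/andP/imsetP => [[_ /cards2P[i [j [ij ->]]]]|[[i j] /=]].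
    have [lt|ge] := ltnP i j; first by exists (i, j).
    exists (j, i); last by rewrite /= finset.setUC.
    by rewrite inE /= ltn_neqAle ge andbT val_eqE eq_sym.
  by rewrite inE /= => /ltn_ord_neq ij ->; rewrite cards2 ij.
- rewrite -(big_imset (h := fun i : 'I_n => [set i]%SET) G (A := predT)) /=;
    last by move=> i j _ _ /set1_inj.
  apply: eq_bigl => D; apply/idP/imsetP => [/andP[_ /cards1P[i ->]]|[i _ ->]];
    first by exists i.
  by rewrite cards1.
rewrite (big_pred1 finset.set0) // => D; rewrite /= -cards_eq0.
by case: #|D| => [|[|[|m]]].
Qed.

Lemma card_small_support : #|{: {J : grid a | small_support J}}| =
  (\sum_(i < n) \sum_(j < n | i < j) a i * a j + \sum_(i < n) a i + 1)%N.
Proof.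
rewrite card_sig -sum1_card
  (partition_big grid_supp (fun D => #|D| <= 2)%N) //=.
transitivity (\sum_(D : {set 'I_n} | (#|D| <= 2)%N) \prod_(i in D) a i)%N.
  apply: eq_bigr => D D2; rewrite -card_grid_supp -sum1_card;
    apply: eq_bigl => J.
  by rewrite !inE /small_support; case: eqP => [->|]; rewrite ?D2 ?andbF.
rewrite sum_sets_le2 finset.big_set0; congr (_ + _ + _)%N.
  apply: eq_bigr => i _; apply: eq_bigr => j /ltn_ord_neq ij.
  by rewrite big_setU1 ?big_set1 // inE.
by apply: eq_bigr => i _; rewrite big_set1.
Qed.

End SmallSupport.

Section CubeEquations.
Variables (R : realType) (n : nat) (a : 'I_n -> nat).
Implicit Types (I : multinom n) (J : grid a) (i j k l : 'I_n) (D : {set 'I_n}).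

Lemma of_grid_shift J D :
  fits J D -> of_grid (grid_shift J D) = of_grid J + indicator D.
Proof.
move=> /forall_inP JD; apply/mnmP => i;
  rewrite mnmDE indicatorE !of_gridE ffunE inordK // ltnS.
by case: (boolP (i \in D)) => [/JD|_]; rewrite ?addn1 // addn0 -ltnS ltn_ord.
Qed.

Lemma fits_box J D : fits J D -> in_box a (of_grid J + indicator D).
Proof. by move/of_grid_shift <-; exact: of_grid_box. Qed.

Lemma box_fits I D : in_box a (I + indicator D) -> fits (to_grid a I) D.
Proof.
move=> box; apply/forall_inP => i iD; rewrite to_gridE ?(in_boxDl box) //.
by have /in_boxP/(_ i) := box; rewrite mnmDE indicatorE iD addn1.
Qed.

Lemma rmorph_cube_eq (S : comPzRingType)
    (phi : {rmorphism ambient R a -> S}) J j k l :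
  (j < k)%N -> (k < l)%N -> fits J [set j; k; l]%SET ->
  phi (cube_eq R J j k l) = 0 <->
  cube_rel (fun I => phi (xvar R (to_grid a I))) (of_grid J) j k l.
Proof.
move=> jk kl fits_jkl; have jl := ltn_trans jk kl.
have shiftE D : D \subset [set j; k; l]%SET ->
    grid_shift J D = to_grid a (of_grid J + indicator D).
  move=> /fintype.subsetP sub; rewrite -of_grid_shift ?of_gridK //.
  by apply/forall_inP => i /sub; move/forall_inP: fits_jkl; apply.
rewrite /cube_eq !shiftE ?finset.sub0set ?finset.subUset ?finset.sub1set ?inE
  ?eqxx ?orbT //.
rewrite indicator0 !indicator1 !indicator2 ?indicator3
  ?ltn_ord_neq // !addrA addr0.
by rewrite rmorphB !rmorphD !rmorphM; split=> [/eqP|->];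
  rewrite ?subrr // subr_eq0 => /eqP.
Qed.

Lemma eq_cube_rel (K : pzRingType) (f g : multinom n -> K) I j k l :
  in_box a (I + e j + e k + e l) -> (forall I', in_box a I' -> f I' = g I') ->
  cube_rel f I j k l -> cube_rel g I j k l.
Proof.
move=> /in_boxP box fg; rewrite /cube_rel !fg //;
  by apply/in_boxP => i; apply: leq_trans (box i); rewrite !mnmDE; lia.
Qed.

End CubeEquations.

Section GridPoints.
Variables (R : realType) (n : nat) (a : 'I_n -> nat) (K : fieldType).
Variables (iota : {rmorphism R[i] -> K}) (f : multinom n -> K).
Hypothesis f_neq0 : forall I, f I != 0.
Hypothesis f_cube_rel : forall I (j k l : 'I_n), (j < k)%N -> (k < l)%N ->
  cube_rel f I j k l.
Implicit Types J : grid a.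

Definition grid_point (i : 'I_(#|{: grid a}| + #|{: grid a}|)) : K :=
  match fintype.split i with
  | inl j => f (of_grid (enum_val j))
  | inr j => (f (of_grid (enum_val j)))^-1
  end.

Definition point_eval : ambient R a -> K := mmap iota grid_point.

HB.instance Definition _ := GRing.RMorphism.on point_eval.

Lemma point_evalC c : point_eval (mpolyC _ c) = iota c.
Proof. by rewrite /point_eval mmapC. Qed.

Lemma point_eval_xvar J : point_eval (xvar R J) = f (of_grid J).
Proof.
rewrite /point_eval mmapX mmap1U /grid_point
  -[lshift _ _]/(unsplit (inl _)) unsplitK.
by rewrite enum_rankK.
Qed.

Lemma point_eval_yvar J : point_eval (yvar R J) = (f (of_grid J))^-1.
Proof.
rewrite /point_eval mmapX mmap1U /grid_point
  -[rshift _ _]/(unsplit (inr _)) unsplitK.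
by rewrite enum_rankK.
Qed.

Lemma point_eval_relation p : @relations R n a p -> point_eval p = 0.
Proof.
case=> [[J ->]|[J [j [k [l [jk kl fits_jkl ->]]]]]].
  by rewrite rmorphB rmorphM rmorph1 /= point_eval_xvar
    point_eval_yvar divff ?subrr.
apply/rmorph_cube_eq => //;
  apply: (eq_cube_rel (a := a)) (f_cube_rel _ jk kl) => [|I I_box].
  have jl := ltn_trans jk kl.
  by have := fits_box fits_jkl; rewrite indicator3 ?ltn_ord_neq // !addrA.
by rewrite /= point_eval_xvar to_gridK.
Qed.

Lemma eq_point_eval p q :
  gquot_pi (@relations R n a) p = gquot_pi (@relations R n a) q ->
  point_eval p = point_eval q.
Proof.
move/gquot_eqP/asboolP => [s [s_rel pq]]; apply/eqP;
  rewrite -subr_eq0 -rmorphB pq.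
rewrite rmorph_sum big_seq big1 // => cg cg_s.
by rewrite rmorphM /= (point_eval_relation (p := cg.2)) ?mulr0 //; exact: s_rel.
Qed.

End GridPoints.

Section CoordinateRing.
Variables (R : realType) (n : nat) (a : 'I_n -> nat).
Notation C := R[i].
Notation A := (coord_ring R a).
Notation pi_A := (gquot_pi (@relations R n a)).
Implicit Types (I : multinom n) (J : grid a) (j k l : 'I_n).

Lemma pi_A_relation p : @relations R n a p -> pi_A p = 0.
Proof.
move=> p_rel; rewrite -(rmorph0 pi_A); apply/gquot_eqP/asboolP.
exists [:: (1, p)]; rewrite big_seq1 mul1r subr0; split=> // cg.
by rewrite inE => /eqP ->.
Qed.

Lemma coord_unit J : coord_fun R J * pi_A (yvar R J) = 1.
Proof.
have /pi_A_relation : @relations R n a (xvar R J * yvar R J - 1).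
  by left; exists J.
by rewrite rmorphB rmorphM rmorph1 => /eqP; rewrite subr_eq0 => /eqP.
Qed.

Lemma coord_cube_rel I j k l :
  (j < k)%N -> (k < l)%N -> in_box a (I + e j + e k + e l) ->
  cube_rel (fun I => coord_fun R (to_grid a I)) I j k l.
Proof.
move=> jk kl box; have jl := ltn_trans jk kl.
have jkl_box : in_box a (I + indicator [set j; k; l]%SET).
  by rewrite indicator3 ?ltn_ord_neq // !addrA.
rewrite -(to_gridK (in_boxDl jkl_box)); apply/(rmorph_cube_eq pi_A) => //;
  first exact: box_fits.
by apply: pi_A_relation; right; exists (to_grid a I), j, k, l; split=> //;
  exact: box_fits.
Qed.

Section Family.
Variables (V : finType) (g : V -> grid a).

Definition lift_family : mpoly #|V| C -> ambient R a :=
  mmap (@mpolyC _ C) (fun i => xvar R (g (enum_val i))).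

HB.instance Definition _ := GRing.RMorphism.on lift_family.

Definition family_map : {rmorphism mpoly #|V| C -> A} := pi_A \o lift_family.

Lemma lift_familyX i :
  lift_family (mpolyX C (mnm1 i)) = xvar R (g (enum_val i)).
Proof. by rewrite /lift_family mmapX mmap1U. Qed.

Lemma lift_familyC c : lift_family (mpolyC _ c) = mpolyC _ c.
Proof. by rewrite /lift_family mmapC. Qed.

Lemma mp_eval_family p :
  mp_eval (scalar_map R a) (fun v => coord_fun R (g v)) p = family_map p.
Proof.
rewrite /mp_eval /= /lift_family /mmap rmorph_sum; apply: eq_bigr => m _.
rewrite rmorphM; congr (_ * _); rewrite /mmap1 rmorph_prod;
  apply: eq_bigr => i _.
by rewrite rmorphXn.
Qed.

Lemma point_eval_family (K : fieldType) (iota : {rmorphism C -> K})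
    (f : multinom n -> K) :
  point_eval iota f \o lift_family =1
  mmap iota (fun i => f (of_grid (g (enum_val i)))).
Proof.
apply: eq_rmorph_mpoly => [c|i] /=;
  first by rewrite lift_familyC point_evalC mmapC.
by rewrite lift_familyX point_eval_xvar mmapX mmap1U.
Qed.

Lemma fractional_coord v : fractional family_map (coord_fun R (g v)).
Proof.
have -> : coord_fun R (g v) = family_map (mpolyX C (mnm1 (enum_rank v))).
  by rewrite /= lift_familyX enum_rankK.
exact: fractional_image.
Qed.

Lemma coord_fractional_all :
  (forall J, fractional family_map (coord_fun R J)) ->
  forall x : A, fractional family_map x.
Proof.
move=> coord_frac x; have -> : x = pi_A (repr x) by rewrite /gquot_pi reprK.
elim/mpoly_ring_ind: (repr x) => [c|i|p q pF qF|p q pF qF].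
- by rewrite -lift_familyC; exact: (fractional_image family_map).
- rewrite -(splitK i); case: (fintype.split i) => j /=; rewrite -(enum_valK j).
    exact: coord_frac.
  exact: fractional_inv (coord_frac _) (coord_unit _).
- by rewrite rmorphD; exact: fractionalD.
by rewrite rmorphM; exact: fractionalM.
Qed.

(* x = b / c is a root of the polynomial c X - b. *)
Lemma fractional_algebraic_over x : (1 : A) <> 0 -> fractional family_map x ->
  algebraic_over (scalar_map R a) (fun v => coord_fun R (g v)) x.
Proof.
move=> A_neq0 [c [b [[u cu] cx]]].
exists 2%N, (fun i : 'I_2 => if i == ord0 then - b else c); split.
  exists (lift ord0 ord0); rewrite mp_eval_family => c0.
  by apply: A_neq0; rewrite -cu [family_map c]c0 mul0r.
have root : family_map (- b) * x ^+ 0 + family_map c * x ^+ 1 = 0.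
  by rewrite rmorphN expr0 mulr1 expr1 cx addNr.
by rewrite big_ord_recl big_ord1 !mp_eval_family; exact: root.
Qed.

End Family.

Definition small_family (v : {J : grid a | small_support J}) : grid a := val v.
Notation small_map := (family_map small_family).

Definition small_point (i : 'I_#|{: {J : grid a | small_support J}}|) :
  multinom n := of_grid (small_family (enum_val i)).

Lemma small_family_fractional x : fractional small_map x.
Proof.
move: x; apply: coord_fractional_all => J; rewrite -(of_gridK J).
move: (of_grid_box J); move: (of_grid J) => I.
move: {2}(mdeg I) (erefl (mdeg I)) => m; elim/ltn_ind: m I => m IH I Im I_box.
have [small|large] := boolP (small_support (to_grid a I)).
  exact: (fractional_coord small_family (Sub (to_grid a I) small :
    {J : grid a | small_support J})).
rewrite /small_support -size_supp_seq_of_grid to_gridK // -ltnNge in large.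
case sE : (supp_seq I) large => [|j [|k [|l s]]] // _.
have [I' [jk kl IE]] := supp_seq3P sE; subst I.
have frac I0 : (mdeg I0 <= mdeg I' + 2)%N ->
    (forall i, (I0 i <= (I' + e j + e k + e l)%R i)%N) ->
      fractional small_map (coord_fun R (to_grid a I0)).
  move=> deg le; apply: (IH (mdeg I0)) => //;
    first by rewrite -Im !mdegD !mdeg1; lia.
  by apply/in_boxP => i; apply: leq_trans (le i) _; apply/in_boxP: i.
apply: (fractional_divl _ (coord_unit (to_grid a I'))).
  by apply: frac => [|i]; rewrite ?mnmDE; lia.
rewrite (cube_rel_mul_top (coord_cube_rel jk kl I_box)).
apply: fractionalD; first apply: fractionalD; try apply: fractionalN.
all: by apply: fractionalM; apply: frac => [|i];
  rewrite ?(mdegD, mdeg1, mnmDE); lia.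
Qed.

Lemma small_point_inj : injective small_point.
Proof.
move=> i j /(congr1 (@to_grid n a)); rewrite !of_gridK.
by move/val_inj/enum_val_inj.
Qed.

Lemma size_supp_small_point i : (size (supp_seq (small_point i)) <= 2)%N.
Proof. by rewrite size_supp_seq_of_grid; exact: valP (enum_val i). Qed.

(* The generic solution is a point of the coordinate ring over the field of
   fractions of the polynomial ring in the small coordinates. *)
Lemma small_family_inj b : small_map b = 0 -> b = 0.
Proof.
have [f [f_neq0 f_cube f_small]] :=
  generic_cube_solution C small_point_inj size_supp_small_point.
move=> b0; pose iota :=
  @FracField.tofrac _ \o @mpolyC #|{: {J : grid a | small_support J}}| C.
have tofracE : mmap iota (fun i => f (small_point i)) =1 @FracField.tofrac _.
  by apply: eq_rmorph_mpoly => [c|i] /=; rewrite ?mmapC // mmapX mmap1U f_small.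
apply/eqP; rewrite -tofrac_eq0 -tofracE -point_eval_family /=.
by rewrite (eq_point_eval iota f_neq0 f_cube (q := 0)) ?rmorph0.
Qed.

Lemma small_family_unit c u : small_map c * u = 1 ->
  meval (fun i => tan_solution C (small_point i)) c != 0.
Proof.
have uE : u = pi_A (repr u) by rewrite /gquot_pi reprK.
rewrite uE -[small_map c]/(pi_A (lift_family small_family c)) -rmorphM
  -(rmorph1 pi_A).
move=> /(eq_point_eval idfun (tan_solution_neq0 C) (tan_solution_cube_rel C)).
rewrite rmorph1 rmorphM
  -[X in X * _]/((point_eval _ _ \o lift_family small_family) c).
rewrite point_eval_family => cu; apply/eqP => c0.
by move/eqP: cu; rewrite [mmap _ _ _]c0 mul0r eq_sym oner_eq0.
Qed.

Lemma coord_ring_integral_domain : integral_domain A.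
Proof.
exact: fractional_integral_domain small_family_fractional small_family_inj.
Qed.

Lemma coord_ring_krull_dim : krull_dim_eq A
  (\sum_(i < n) \sum_(j < n | i < j) a i * a j + \sum_(i < n) a i + 1)%N.
Proof.
rewrite -card_small_support.
exact: fractional_krull_dim small_family_fractional small_family_inj _
  small_family_unit.
Qed.

Section Tiling.
Variables (theta : 'I_n -> R) (T : {set cell a}).
Hypothesis n_gt0 : (0 < n)%N.
Hypothesis a_gt0 : forall i, (0 < a i)%N.
Hypothesis theta_bound : forall i, 0 < theta i < pi.
Hypothesis theta_incr : forall i j : 'I_n, (i < j)%N -> theta i < theta j.
Hypothesis T_tiling : tiling theta T.

Notation vertT := {J : grid a | J \in vert T}.
Notation vert_map := (family_map (fun v : vertT => val v)).

Let tiled := tiling_tile_complex n_gt0 a_gt0 theta_bound theta_incr T_tiling.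

Lemma fractional_flip_closed (V : finType) (g : V -> grid a) :
  flip_closed a
    (fun I => fractional (family_map g) (coord_fun R (to_grid a I))).
Proof.
move=> I j k l jk kl box frac_I frac_j frac_l frac_jk frac_kl frac_jkl.
have frac_prod :
    fractional (family_map g) (coord_fun R (to_grid a (I + e j + e l)) *
      coord_fun R (to_grid a (I + e k))).
  rewrite (coord_cube_rel jk kl box).
  by apply: fractionalD; first apply: fractionalD; apply: fractionalM.
split=> [frac_k|frac_jl].
  by rewrite mulrC in frac_prod;
    apply: fractional_divl frac_k (coord_unit _) frac_prod.
exact: fractional_divl frac_jl (coord_unit _) frac_prod.
Qed.

Lemma tiling_family_fractional x : fractional vert_map x.
Proof.
move: x; apply: coord_fractional_all => J; rewrite -(of_gridK J).
have flip := @fractional_flip_closed _ (fun v : vertT => val v).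
apply: (tile_complex_determines_box tiled flip) (of_grid_box J) => v [_ vT].
have v_vert : to_grid a v \in vert T by rewrite inE.
exact: (fractional_coord (fun v : vertT => val v)
  (Sub (to_grid a v) v_vert : vertT)).
Qed.

Lemma card_vert_le : (#|{: vertT}| <=
  \sum_(i < n) \sum_(j < n | i < j) a i * a j + \sum_(i < n) a i + 1)%N.
Proof.
have [L VL size_L] := tile_complex_vertices_le tiled; apply: leq_trans size_L.
rewrite cardE -(size_map (fun J : vertT => of_grid (val J)));
  apply: uniq_leq_size.
  by rewrite map_inj_uniq ?enum_uniq // => J J'
    /(can_inj (@of_gridK _ _))/val_inj.
move=> _ /mapP[J _ ->]; apply: VL; apply: grid_lattice_cell;
  first by case: T_tiling.
by have := valP J; rewrite inE.
Qed.

(* A relation among the coordinates at the vertices would allow the maximal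
   chain of primes to be lengthened in a polynomial ring in card_vert_le many
   variables. *)
Lemma tiling_transcendence_basis :
  transcendence_basis (scalar_map R a) (fun J : vertT => coord_fun R (val J)).
Proof.
have [[p chain_p] _] := coord_ring_krull_dim.
have [A_neq0 _] := coord_ring_integral_domain.
split=> [q|x];
  last exact: fractional_algebraic_over A_neq0 (tiling_family_fractional x).
rewrite (mp_eval_family (fun J : vertT => val J)).
exact: (long_prime_chain_inj tiling_family_fractional chain_p card_vert_le).
Qed.

End Tiling.
End CoordinateRing.

Theorem theorem4p3 (R : realType) (n : nat) (a : 'I_n -> nat)
    (theta : 'I_n -> R)
    (n_ge3 : (3 <= n)%N)
    (a_gt0 : forall i, (0 < a i)%N)
    (theta_bound : forall i, 0 < theta i < pi)
    (theta_incr : forall i j : 'I_n, (i < j)%N -> theta i < theta j) :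
  [/\ integral_domain (coord_ring R a),
      krull_dim_eq (coord_ring R a)
        (\sum_(i < n) \sum_(j < n | i < j) a i * a j +
         \sum_(i < n) a i + 1)%N &
      forall T : {set cell a}, tiling theta T ->
        transcendence_basis (scalar_map R a)
          (fun J : {J : grid a | J \in vert T} => coord_fun R (val J))].
Proof.
split=> [||T T_tiling].
- exact: coord_ring_integral_domain.
- exact: coord_ring_krull_dim.
exact: tiling_transcendence_basis (leq_trans _ n_ge3) a_gt0 theta_bound
  theta_incr T_tiling.
Qed.
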